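(* Let $p$ be an odd prime, let $G$ be a branch group in $\mathscr{C}$ and let $E$ be an algebraically closed field of characteristic $p$. If the group algebra $E[G]$ has a non-trivial irreducible module, then $E[G]$ has infinitely many (pairwise non-isomorphic) irreducible modules.
   Context: Let $p$ be an odd prime. $T$ is the regular $p$-adic rooted tree: its vertices $u_\omega$ are indexed by the finite words $\omega$ over $X=\{1,\ldots,p\}$, the root being the empty word, with an edge from $u_\omega$ to $u_{\omega x}$ for each $x\in X$; the $n$th level consists of the $u_\omega$ with $|\omega|=n$. Automorphisms act on the right. $\psi_1\colon \mathrm{Stab}_{\mathrm{Aut}(T)}(1)\to \mathrm{Aut}(T)\times\overset{p}{\ldots}\times\mathrm{Aut}(T)$ is the natural isomorphism from the pointwise stabiliser of the first level, given by restriction to the subtrees rooted at the first-level vertices $u_1,\ldots,u_p$ (each naturally identified with $T$). The class $\mathscr{C}$. Let $a$ be the rooted automorphism that permutes the first-level vertices (with their subtrees) according to the $p$-cycle $(1\;2\;\ldots\;p)$. A datum $\mathbf{E}=(\mathbf{E}^{(1)},\ldots,\mathbf{E}^{(p)})$ consists, for each $j\in\{1,\ldots,p\}$, of an integer $r_j\in\{0,\ldots,p-1\}$, with $r_j\neq 0$ for at least one $j$, and an $r_j$-tuple $\mathbf{E}^{(j)}=(\mathbf{e}^{(j)}_1,\ldots,\mathbf{e}^{(j)}_{r_j})$ of linearly independent vectors $\mathbf{e}^{(j)}_i=(e^{(j)}_{i,1},\ldots,e^{(j)}_{i,p-1})\in(\mathbb{Z}/p\mathbb{Z})^{p-1}$.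 The generalised multi-edge spinal group in standard form associated to $\mathbf{E}$ is $G_{\mathbf{E}}=\langle \{a\}\cup\{b^{(j)}_i\mid 1\le j\le p,\,1\le i\le r_j\}\rangle$, where $b^{(j)}_i\in\mathrm{Stab}_{\mathrm{Aut}(T)}(1)$ is defined recursively by $$\psi_1(b^{(j)}_i)=\big(a^{e^{(j)}_{i,j}},\ldots,a^{e^{(j)}_{i,p-1}},b^{(j)}_i,a^{e^{(j)}_{i,1}},\ldots,a^{e^{(j)}_{i,j-1}}\big),$$ with $b^{(j)}_i$ in coordinate $p-j+1$. The class $\mathscr{C}$ consists of all subgroups of $\mathrm{Aut}(T)$ that are conjugate in $\mathrm{Aut}(T)$ to some $G_{\mathbf{E}}$. For $G\le\mathrm{Aut}(T)$ and a vertex $u$, $\mathrm{Rstab}_G(u)$ is the subgroup of elements of $G$ fixing all vertices that are not in the full subtree rooted at $u$, and $\mathrm{Rstab}_G(n)=\prod_{|\omega|=n}\mathrm{Rstab}_G(u_\omega)$. $G$ is branch if it acts transitively on each level of $T$ and $\mathrm{Rstab}_G(n)$ has finite index in $G$ for all $n$. The trivial irreducible $E[G]$-module is the $1$-dimensional module on which $G$ acts trivially. *)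

(* Defs.v *)
From HB Require Import structures.
From mathcomp Require Import all_boot all_order all_algebra finmap.
From mathcomp.multinomials Require Import monalg.
From mathcomp.classical Require Import boolp classical_sets cardinality.

Set Implicit Arguments.
Unset Strict Implicit.
Unset Printing Implicit Defensive.

Import GRing.Theory.
Local Open Scope ring_scope.
Local Open Scope classical_set_scope.

Section Tree.
Variable p : nat.

(* The letters 1, ..., p are represented by 0, ..., p.-1 : 'I_p, and the       *)
(* vertex u_w by the word w.                                                   *)
Definition vertex := seq 'I_p.

Definition edge (u v : vertex) : bool := [exists x, v == rcons u x].

Lemma edgeP u v : reflect (exists x, v = rcons u x) (edge u v).
Proof. by apply: (iffP existsP) => -[x]; [move/eqP; exists x | move->; exists x]. Qed.

Definition tree_aut (f : vertex -> vertex) : Prop :=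
  bijective f /\ forall u v, edge (f u) (f v) = edge u v.

Record aut := Aut { aut_fun :> vertex -> vertex; autP : tree_aut aut_fun }.

HB.instance Definition _ := gen_eqMixin aut.
HB.instance Definition _ := gen_choiceMixin aut.

Lemma aut_ext (f g : aut) : f =1 g -> f = g.
Proof.
case: f g => f fP [g gP] /= /funext fg; case: g / fg gP => gP.
by congr Aut; exact: Prop_irrelevance.
Qed.

Lemma tree_aut_can (f g : vertex -> vertex) : cancel f g -> cancel g f ->
  (forall u v, edge u v -> edge (f u) (f v)) ->
  (forall u v, edge u v -> edge (g u) (g v)) -> tree_aut f.
Proof.
move=> fK gK fe ge; split; first by exists g.
move=> u v; apply/idP/idP => [/ge|]; last exact: fe.
by rewrite !fK.
Qed.

Lemma tree_aut_id : tree_aut id.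
Proof. exact: (@tree_aut_can id id). Qed.

Lemma tree_aut_comp f g : tree_aut f -> tree_aut g -> tree_aut (g \o f).
Proof.
move=> [fb fe] [gb ge]; split; first exact: bij_comp.
by move=> u v /=; rewrite ge fe.
Qed.

Lemma aut_inv_ex (f : aut) :
  exists g : aut, cancel f g /\ cancel g f.
Proof.
have [[g fK gK] fe] := autP f.
have gP : tree_aut g.
  by split; [exists f | move=> u v; rewrite -fe !gK].
by exists (Aut gP).
Qed.

Definition aut_one := Aut tree_aut_id.
(* Automorphisms act on the right: f * g means "f, then g".                    *)
Definition aut_mul (f g : aut) := Aut (tree_aut_comp (autP f) (autP g)).
Definition aut_inv (f : aut) : aut := projT1 (cid (aut_inv_ex f)).

Lemma aut_invK (f : aut) : cancel f (aut_inv f).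
Proof. by rewrite /aut_inv; case: cid => g []. Qed.

Lemma aut_invVK (f : aut) : cancel (aut_inv f) f.
Proof. by rewrite /aut_inv; case: cid => g []. Qed.

Fact aut_mulA : associative aut_mul.
Proof. by move=> f g h; apply: aut_ext. Qed.
Fact aut_mul1 : left_id aut_one aut_mul.
Proof. by move=> f; apply: aut_ext. Qed.
Fact aut_mulr1 : right_id aut_one aut_mul.
Proof. by move=> f; apply: aut_ext. Qed.
Fact aut_mulV : left_inverse aut_one aut_inv aut_mul.
Proof. by move=> f; apply: aut_ext => u /=; rewrite aut_invVK. Qed.
Fact aut_mulrV : right_inverse aut_one aut_inv aut_mul.
Proof. by move=> f; apply: aut_ext => u /=; rewrite aut_invK. Qed.

HB.instance Definition _ := isGroup.Build aut
  aut_mulA aut_mul1 aut_mulr1 aut_mulV aut_mulrV.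

Lemma aut_nil (f : aut) : f [::] = [::].
Proof.
have [[g fK gK] fe] := autP f.
case/lastP E: (g [::]) => [|w x]; first by rewrite -[in LHS]E gK.
have : edge w (g [::]) by rewrite E; apply/edgeP; exists x.
by rewrite -fe gK => /edgeP[y /(congr1 size)]; rewrite size_rcons.
Qed.

Lemma aut_rcons (f : aut) u x : exists y, f (rcons u x) = rcons (f u) y.
Proof. by apply/edgeP; rewrite (autP f).2; apply/edgeP; exists x. Qed.

Definition rooted_fun (s : 'I_p -> 'I_p) (w : vertex) : vertex :=
  if w is x :: v then s x :: v else [::].

Lemma edge_rooted s u v : edge u v -> edge (rooted_fun s u) (rooted_fun s v).
Proof.
move=> /edgeP[x ->]; apply/edgeP.
by case: u => [|y u]; [exists (s x) | exists x].
Qed.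

Lemma tree_aut_rooted : tree_aut (rooted_fun (@ordS p)).
Proof.
apply: (@tree_aut_can _ (rooted_fun (@ord_pred p))); try exact: edge_rooted.
- by case=> //= x v; rewrite ordSK.
- by case=> //= x v; rewrite ord_predK.
Qed.

(* The rooted automorphism a: x |-> x + 1 mod p on the first level.            *)
Definition rot_a : aut := Aut tree_aut_rooted.

Fixpoint spinal_fun (k : 'I_p) (t : nat -> aut) (w : vertex) : vertex :=
  if w is x :: v then x :: (if x == k then spinal_fun k t v else t x v)
  else [::].

Lemma edge_spinal k t u v :
  edge u v -> edge (spinal_fun k t u) (spinal_fun k t v).
Proof.
move=> /edgeP[x ->]; apply/edgeP.
elim: u => [|y u [z IH]] /=; first by exists x; case: eqP; rewrite ?aut_nil.
case: eqP => _; first by exists z; rewrite IH.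
by have [z' ->] := aut_rcons (t y) u x; exists z'.
Qed.

Lemma tree_aut_spinal k t : tree_aut (spinal_fun k t).
Proof.
apply: (@tree_aut_can _ (spinal_fun k (fun x => aut_inv (t x))));
  try exact: edge_spinal.
- by elim=> //= x v IH; case: eqP => [_|]; rewrite ?IH ?aut_invK.
- by elim=> //= x v IH; case: eqP => [_|]; rewrite ?IH ?aut_invVK.
Qed.

(* The element b of Stab(1) with psi_1(b) = (t 0, ..., t p.-1), except that    *)
(* its coordinate k is b itself.                                               *)
Definition spinal k t : aut := Aut (tree_aut_spinal k t).

Definition Rstab (G : set aut) (u : vertex) : set aut :=
  [set g | G g /\ forall w, ~~ prefix u w -> g w = w].

Definition RstabL (G : set aut) (n : nat) : set aut :=
  [set (\prod_(w : n.-tuple 'I_p) h w)%g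
     | h in [set h : n.-tuple 'I_p -> aut | forall w : n.-tuple _, Rstab G w (h w)]].

Definition level_transitive (G : set aut) : Prop :=
  forall u v : vertex, size u = size v -> exists2 g, G g & g u = v.

End Tree.

Section Groups.
Variable gT : groupType.

(* Finitely many right cosets H g with g in G.                                 *)
Definition finite_index (H G : set gT) : Prop :=
  finite_set [set [set (h * g)%g | h in H] | g in G].

Definition generated (S : set gT) : set gT :=
  [set x | forall H : groupClosed gT, S `<=` [set` H] -> x \in H].

End Groups.

Definition branch p (G : set (aut p)) : Prop :=
  level_transitive G /\ forall n, finite_index (RstabL G n) G.

Record datum (p : nat) := Datum {
  rk : 'I_p -> 'I_p;
  rk_neq0 : exists j, (rk j != 0 :> nat)%N;
  vec : forall j, 'M['F_p]_(rk j, p.-1);  (* the rows are the e^(j)_i *)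
  vec_free : forall j, row_free (vec j) }.

Section Spinal.
Variables (p : nat) (D : datum p).

(* a^(e^(j)_{i,1}), ..., a^(e^(j)_{i,p-1})                                     *)
Definition a_powers (j : 'I_p) (i : 'I_(rk D j)) : seq (aut p) :=
  [seq (rot_a p ^+ vec D j i m)%g | m <- enum 'I_p.-1].

(* rev_ord j is 0-based for the coordinate p-j+1; the entry 1 in that position *)
(* is a placeholder which spinal ignores.                                      *)
Definition gen_b (j : 'I_p) (i : 'I_(rk D j)) : aut p :=
  spinal (rev_ord j)
    (nth 1%g (drop j (a_powers i) ++ 1%g :: take j (a_powers i))).

Lemma gen_b_psi1 (j : 'I_p) (i : 'I_(rk D j)) (x : 'I_p) (v : vertex p) :
  gen_b i (x :: v) =
    x :: nth 1%g (drop j (a_powers i) ++ gen_b i :: take j (a_powers i)) x v.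
Proof.
have sz : size (drop j (a_powers i)) = rev_ord j.
  by rewrite size_drop size_map size_enum_ord /= subnS -subn1 subnAC subn1.
rewrite [LHS]/=; congr (_ :: _); rewrite !nth_cat sz -val_eqE.
case: ltngtP => //= [|->]; last by rewrite subnn.
by rewrite -subn_gt0; case: subn.
Qed.

Definition spinal_group : set (aut p) :=
  generated ([set rot_a p] `|`
             [set b | exists j, exists i : 'I_(rk D j), b = gen_b i]).

End Spinal.

Definition class_C p (G : set (aut p)) : Prop :=
  exists (D : datum p) (f : aut p), G = [set (h ^ f)%g | h in spinal_group D].

Section SubgroupType.
Variables (gT : groupType) (G : groupClosed gT).

Definition sgroup := {x : gT | x \in G}.
HB.instance Definition _ := SubChoice.on sgroup.

Fact sgroup_closed : group_closed G.
Proof. by split; [exact: gpred1 | exact: gpredF]. Qed.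

HB.instance Definition _ :=
  SubChoice_isSubGroup.Build gT (mem G) sgroup sgroup_closed.

End SubgroupType.

(* {malg E[K]} carries a ring structure only for a monomType K, which excludes *)
(* non-trivial groups, hence this copy of it with the convolution product.     *)
Definition grpalg (E : nzRingType) (gT : groupType) := {malg E[gT]}.

Section GroupAlgebra.
Variables (E : nzRingType) (gT : groupType).
Local Notation A := (grpalg E gT).
Implicit Types (x y z : A) (g h : gT).

HB.instance Definition _ := GRing.Lmodule.on A.

Definition grpalg_one : A := << 1 *g 1%g >>.

Definition grpalg_mul x y : A :=
  \sum_(g <- msupp x) \sum_(h <- msupp y) << x@_g * y@_h *g (g * h)%g >>.

Lemma grpalg_mulE (d1 d2 : {fset gT}) x y :
  (msupp x `<=` d1)%fset -> (msupp y `<=` d2)%fset ->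
  grpalg_mul x y =
  \sum_(g <- d1) \sum_(h <- d2) << x@_g * y@_h *g (g * h)%g >>.
Proof.
move=> le_d1 le_d2; rewrite /grpalg_mul (big_fset_incl _ le_d1) /=.
  apply/eq_bigr=> g _; apply/big_fset_incl => // h _ /mcoeff_outdom ->.
  by rewrite mulr0 monalgU0.
move=> g _ /mcoeff_outdom xg.
by rewrite big1 => // h _; rewrite xg mul0r monalgU0.
Qed.

Let sub_refl x : (msupp x `<=` msupp x)%fset := fsubset_refl _.

Lemma grpalg_mul0 : left_zero 0 grpalg_mul.
Proof. by move=> x; rewrite /grpalg_mul msupp0 big_seq_fset0. Qed.

Lemma grpalg_mulr0 : right_zero 0 grpalg_mul.
Proof.
by move=> x; rewrite /grpalg_mul big1 // => g _; rewrite msupp0 big_seq_fset0.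
Qed.

Lemma grpalg_mulUl (c : E) g y :
  grpalg_mul << c *g g >> y =
  \sum_(h <- msupp y) << c * y@_h *g (g * h)%g >>.
Proof.
rewrite (grpalg_mulE msuppU_le (sub_refl y)) big_seq_fset1.
by apply/eq_bigr => h _; rewrite mcoeffUU.
Qed.

Lemma grpalg_mulUr (c : E) h x :
  grpalg_mul x << c *g h >> =
  \sum_(g <- msupp x) << x@_g * c *g (g * h)%g >>.
Proof.
rewrite (grpalg_mulE (sub_refl x) msuppU_le).
by apply/eq_bigr => g _; rewrite big_seq_fset1 mcoeffUU.
Qed.

Lemma grpalg_mulUU (c d : E) g h :
  grpalg_mul << c *g g >> << d *g h >> = << c * d *g (g * h)%g >>.
Proof.
by rewrite (grpalg_mulE msuppU_le msuppU_le) !big_seq_fset1 !mcoeffUU.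
Qed.

Fact grpalg_mul1 : left_id grpalg_one grpalg_mul.
Proof.
move=> x; rewrite grpalg_mulUl [RHS]monalgE.
by apply/eq_bigr=> g _; rewrite mul1r mul1g.
Qed.

Fact grpalg_mulr1 : right_id grpalg_one grpalg_mul.
Proof.
move=> x; rewrite grpalg_mulUr [RHS]monalgE.
by apply/eq_bigr=> g _; rewrite mulr1 mulg1.
Qed.

Fact grpalg_mulDl : left_distributive grpalg_mul +%R.
Proof.
move=> x y z.
rewrite [in RHS](grpalg_mulE (fsubsetUl _ (msupp y)) (sub_refl z)).
rewrite [in RHS](grpalg_mulE (fsubsetUr (msupp x) _) (sub_refl z)).
rewrite (grpalg_mulE (msuppD_le _ _) (sub_refl z)).
rewrite -big_split /=; apply/eq_bigr=> g _.
rewrite -big_split /=; apply/eq_bigr=> h _.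
by rewrite mcoeffD mulrDl monalgUD.
Qed.

Fact grpalg_mulDr : right_distributive grpalg_mul +%R.
Proof.
move=> x y z.
rewrite [in RHS](grpalg_mulE (sub_refl x) (fsubsetUl _ (msupp z))).
rewrite [in RHS](grpalg_mulE (sub_refl x) (fsubsetUr (msupp y) _)).
rewrite (grpalg_mulE (sub_refl x) (msuppD_le _ _)).
rewrite -big_split /=; apply/eq_bigr=> g _.
rewrite -big_split /=; apply/eq_bigr=> h _.
by rewrite mcoeffD mulrDr monalgUD.
Qed.

Fact grpalg_mulA : associative grpalg_mul.
Proof.
move=> x y z.
pose sl z' := big_morph (grpalg_mul^~ z') (fun _ _ => grpalg_mulDl _ _ _)
  (grpalg_mul0 _).
pose sr z' := big_morph (grpalg_mul z') (fun _ _ => grpalg_mulDr _ _ _)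
  (grpalg_mulr0 _).
have mulEl u v : grpalg_mul u v =
    \sum_(g <- msupp u) grpalg_mul << u@_g *g g >> v.
  by apply/eq_bigr => g _; rewrite grpalg_mulUl.
have mulEr u g c : grpalg_mul << c *g g >> u =
    \sum_(h <- msupp u) grpalg_mul << c *g g >> << u@_h *g h >>.
  by rewrite grpalg_mulUl; apply/eq_bigr => h _; rewrite grpalg_mulUU.
rewrite mulEl [RHS]sl; apply/eq_bigr => g _.
rewrite [LHS]sr [RHS]sl; apply/eq_bigr => h _.
rewrite [LHS]sr mulEr; apply/eq_bigr => k _.
by rewrite !grpalg_mulUU mulrA mulgA.
Qed.

Fact grpalg_one_neq0 : grpalg_one != 0.
Proof. by rewrite monalgU_eq0 oner_eq0. Qed.

HB.instance Definition _ := GRing.Zmodule_isNzRing.Build A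
  grpalg_mulA grpalg_mul1 grpalg_mulr1 grpalg_mulDl grpalg_mulDr
  grpalg_one_neq0.

Fact grpalg_scaleAl (c : E) x y : c *: (x * y) = (c *: x) * y.
Proof.
have -> : c *: x * y = grpalg_mul (c *: x) y by [].
have -> : x * y = grpalg_mul x y by [].
rewrite (grpalg_mulE (msuppZ_le c x) (sub_refl y)) scaler_sumr.
apply/eq_bigr => g _; rewrite scaler_sumr; apply/eq_bigr => h _.
apply/malgP => k; rewrite !mcoeffsE -mulrA.
by case: eqP => _; rewrite ?mulr1n ?mulr0n ?mulr0.
Qed.

HB.instance Definition _ := GRing.Lmodule_isLalgebra.Build E A grpalg_scaleAl.

Definition gelt (g : gT) : A := << 1 *g g >>.

Lemma geltM g h : gelt (g * h)%g = gelt g * gelt h.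
Proof. by rewrite [RHS]grpalg_mulUU mulr1. Qed.

Lemma gelt1 : gelt 1%g = 1.
Proof. by []. Qed.

End GroupAlgebra.

Arguments gelt E {gT} g.

Definition irreducible_module (A : nzRingType) (M : lmodType A) : Prop :=
  (exists v : M, v != 0) /\
  forall U : submodClosed M,
    (forall v, v \in U -> v = 0) \/ (forall v, v \in U).

Definition module_iso (A : nzRingType) (M N : lmodType A) : Prop :=
  exists f : {linear M -> N}, bijective f.

(* A module over E[gT] is an E-vector space through c |-> c%:A.                *)
Definition trivial_module (E : nzRingType) (gT : groupType)
    (M : lmodType (grpalg E gT)) : Prop :=
  (exists2 v : M, v != 0
     & forall w : M, exists c : E, w = (c%:A : grpalg E gT) *: v) /\
  forall (g : gT) (v : M), gelt E g *: v = v.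

(* Main.v *)
(** For a subgroup X of G consider the condition (T): the augmentation ideal of
    E[X] lies in its Jacobson radical. It passes to subgroups and to quotients.

    If (T) fails for the groups L_v through which Rstab_G(v) acts on the subtree
    at v, then for every set K of vertices of level n one glues matrix
    coefficients of non-trivial irreducible L_v-modules, v in K, to a function on
    G supported on the elements that act on each subtree at level n by an element
    of L_v. It generates a module whose irreducible quotients see exactly |K|
    commuting factors non-trivially; the number |K| is an invariant, so there are
    at least p^n irreducible modules, for every n.

    Suppose that L_u satisfies (T) for some u. As G is branch and the sections at
    u of the stabiliser of u exhaust the spinal group, L_u is normal of finite
    index in it. Let J be a normal subgroup of minimal finite index satisfying
    (T), and let H be the stabiliser of the first level. The image of the
    intersection of H and J under a coordinate map H -> G again has all these
    properties. Minimality gives G = JH and shows that an element of H with a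
    trivial coordinate is in J. For p >= 3, the commutator of two conjugates of
    generators b has a trivial coordinate; these conjugates generate H, so G / J
    is an elementary abelian p-group. On an irreducible module J acts trivially
    by (T) and Clifford theory, and G / J acts trivially in characteristic p. So
    all irreducible modules are trivial. *)

From HB Require Import structures.
Require Import Defs.
From mathcomp Require Import all_boot all_order all_algebra finmap.
From mathcomp Require Import zify.
From mathcomp.multinomials Require Import monalg.
From mathcomp.classical Require Import boolp classical_sets cardinality.

Set Implicit Arguments.
Unset Strict Implicit.
Unset Printing Implicit Defensive.

Import GRing.Theory.
Local Open Scope ring_scope.
Local Open Scope classical_set_scope.

(** * Subgroups and the radical condition *)

Section Subgroups.
Variable gT : groupType.
Implicit Types (X Y J S H : set gT) (x y : gT).

Definition subgrp X := X 1%g /\ forall x y, X x -> X y -> X (x * y^-1)%g.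

Lemma subgrp1 X : subgrp X -> X 1%g. Proof. by case. Qed.

Lemma subgrpV X x : subgrp X -> X x -> X x^-1%g.
Proof. by case=> X1 XM Xx; rewrite -[x^-1%g]mul1g; exact: XM. Qed.

Lemma subgrpM X x y : subgrp X -> X x -> X y -> X (x * y)%g.
Proof.
by move=> sX Xx Xy; rewrite -[y]invgK; apply: sX.2 => //; exact: subgrpV.
Qed.

Lemma subgrpX X x n : subgrp X -> X x -> X (x ^+ n)%g.
Proof.
move=> sX Xx; elim: n => [|n IH]; first by rewrite expg0; exact: subgrp1.
by rewrite expgS; exact: subgrpM.
Qed.

Lemma subgrpI X Y : subgrp X -> subgrp Y -> subgrp (X `&` Y).
Proof.
move=> [X1 XM] [Y1 YM]; split; first by split.
by move=> x y [Xx Yx] [Xy Yy]; split; [exact: XM | exact: YM].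
Qed.

Lemma subgrp_closed (G : groupClosed gT) : subgrp [set` G].
Proof. by split=> [|x y /= xG yG]; [exact: gpred1 | exact: gpredF]. Qed.

Lemma generated_min (A : set gT) X : subgrp X -> A `<=` X -> generated A `<=` X.
Proof.
move=> sX AX x gx.
pose P : {pred gT} := fun x => `[< X x >].
have P1 : 1%g \in P by apply/asboolP; exact: subgrp1.
have PM : {in P &, forall u v, (u * v)%g \in P}.
  by move=> u v /asboolP Xu /asboolP Xv; apply/asboolP; exact: subgrpM.
have PV : {in P, forall u, u^-1%g \in P}.
  by move=> u /asboolP Xu; apply/asboolP; exact: subgrpV.
pose G : groupClosed gT := HB.pack P (isInvClosed.Build gT P PV)
  (isMul1Closed.Build gT P P1) (isMulClosed.Build gT P PM).
by apply/asboolP; apply: (gx G) => y Ay; apply/asboolP; exact: AX.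
Qed.

Lemma sub_generated (A : set gT) : A `<=` generated A.
Proof. by move=> x Ax G /(_ x Ax). Qed.

Lemma subgrp_generated (A : set gT) : subgrp (generated A).
Proof.
split=> [G _|x y gx gy G AG]; first exact: gpred1.
by apply: gpredF; [exact: gx | exact: gy].
Qed.

Lemma subgrp_conj X x : subgrp X -> subgrp [set y | X (y ^ x)%g].
Proof.
move=> [X1 XM]; split=> [|y z /= Xy Xz]; first by rewrite /= conj1g.
by rewrite conjMg conjVg; exact: XM.
Qed.

Definition normalised J S := forall x y, S x -> J y -> J (y ^ x)%g.

(** For a subgroup [J] of [S], a finite list meeting every right coset of [J]. Repetitions are
    allowed, so the length of [t] only bounds the index from above. *)
Definition covers J S (t : seq gT) :=
  (forall y, y \in t -> S y) /\
  forall x, S x -> exists2 y, y \in t & J (x * y^-1)%g.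

End Subgroups.

Section Radical.
Variable E : nzRingType.

(* The augmentation ideal of [E[X]] lies in its Jacobson radical. This is     *)
(* expressed in the dual of [E[X]]: an element b (r - 1) of the augmentation  *)
(* ideal, acting on functions by right translations, fixes no non-zero        *)
(* function. The list [b] stands for the formal sum of its pairs.             *)
Definition aug_radical (gT : groupType) (X : set gT) : Prop :=
  forall (r : gT) (b : seq (E * gT)) (f : gT -> E),
    X r -> (forall ch, ch \in b -> X ch.2) ->
    (forall x, X x ->
       f x = \sum_(ch <- b) ch.1 * (f (x * ch.2 * r)%g - f (x * ch.2)%g)) ->
    forall x, X x -> f x = 0.

(** Extend [f] by zero outside [X]. Right translation by an element of [X] preserves [X] and its
    complement, so the relation survives the extension. *)
Lemma aug_radical_sub (gT : groupType) (X Y : set gT) :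
  subgrp X -> X `<=` Y -> aug_radical Y -> aug_radical X.
Proof.
move=> sX XY TY r b f Xr Xb fE x Xx.
pose f' y := if `[< X y >] then f y else 0.
have f'E y : X y -> f' y = f y by move=> Xy; rewrite /f' asboolT.
have f'0 y : ~ X y -> f' y = 0 by move=> Xy; rewrite /f' asboolF.
have nXM y h : X h -> ~ X y -> ~ X (y * h)%g.
  by move=> Xh nXy Xyh; apply: nXy; rewrite -[y](mulgK h); exact: sX.2.
rewrite -f'E //; apply: (TY r b f') (XY _ Xx) => //; first exact: XY.
- by move=> ch /Xb/XY.
move=> y Yy; case: (pselect (X y)) => Xy.
  rewrite f'E // fE //; apply: eq_big_seq => ch /Xb Xh.
  by rewrite !f'E //; do ?apply: subgrpM.
rewrite f'0 // big_seq big1 // => ch /Xb Xh.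
have nXh := nXM _ _ Xh Xy; have nXhr := nXM _ _ Xr nXh.
by rewrite !f'0 // subr0 mulr0.
Qed.

(** A relation on [Y] pulls back along [phi]: [f] becomes [f \o phi], while [r] and the entries of
    [b] are lifted by a chosen section [l] of [phi]. *)
Lemma aug_radical_image (gT gT' : groupType) (X : set gT) (Y : set gT')
    (phi : gT -> gT') :
  subgrp X ->
  (forall x y, X x -> X y -> phi (x * y)%g = (phi x * phi y)%g) ->
  (forall x, X x -> Y (phi x)) ->
  (forall y, Y y -> exists2 x, X x & phi x = y) ->
  aug_radical X -> aug_radical Y.
Proof.
move=> sX phiM phiY phi_onto TX r b f Yr Yb fE y Yy.
pose l y := if pselect (Y y) is left Yy' then s2val (cid2 (phi_onto y Yy')) else 1%g.
have lX z : Y z -> X (l z) by rewrite /l; case: pselect => // Yz _; case: cid2.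
have lK z : Y z -> phi (l z) = z.
  by rewrite /l; case: pselect => // Yz _; case: cid2.
rewrite -(lK y) //; apply: (TX (l r) [seq (ch.1, l ch.2) | ch <- b] (f \o phi));
  [exact: lX | | | exact: lX].
- by move=> ch /mapP[dh /Yb Yh ->]; exact: lX.
move=> x Xx /=; rewrite fE; last exact: phiY.
rewrite big_map; apply: eq_big_seq => ch /Yb Yh /=.
have lXh := lX _ Yh; have lXr := lX _ Yr.
by rewrite !phiM ?lK //; apply: subgrpM.
Qed.

End Radical.

(** * Normal subgroups of minimal index satisfying the radical condition *)

Section MinimalRadical.
Variables (E : nzRingType) (gT : groupType) (S : set gT).

Definition radical_cover J t :=
  [/\ subgrp J, J `<=` S, normalised J S, aug_radical E J & covers J S t].

Variables (H : set gT) (I : Type) (psi : I -> gT -> gT) (i0 : I).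
Hypotheses (sS : subgrp S) (sH : subgrp H) (HS : H `<=` S).
Hypothesis psiM : forall i x y, H x -> H y -> psi i (x * y)%g = (psi i x * psi i y)%g.
Hypothesis psiS : forall i x, H x -> S (psi i x).
Hypothesis psi_onto : forall i y, S y -> exists2 x, H x & psi i x = y.

Let psi1 i : psi i 1%g = 1%g.
Proof.
apply: (mulIg (psi i 1%g)); rewrite -psiM ?mulg1 ?mul1g //; exact: subgrp1.
Qed.

Let psiV i x : H x -> psi i x^-1%g = (psi i x)^-1%g.
Proof.
move=> Hx; apply: (mulIg (psi i x)); rewrite -psiM // ?mulVg ?psi1 //.
exact: subgrpV.
Qed.

(* The images of [H `&` J] under the [psi i] are again in the class           *)
(* described by [radical_cover], with index at most that of [J]; minimality   *)
(* of the index therefore forces [S = J H] and                                *)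
(* [psi i @^-1` (psi i @` (H `&` J)) `&` H = H `&` J].                        *)
Lemma minimal_radical :
  (exists J t, radical_cover J t) ->
  exists J t, [/\ radical_cover J t,
    forall x, S x -> exists2 h, H h & J (x * h^-1)%g &
    forall i h, H h -> psi i h = 1%g -> J h].
Proof.
move=> exJ.
(* Minimising the length of a covering list amounts to minimising the index. *)
pose P n := `[< exists J t, radical_cover J t /\ size t = n >].
have exP : exists n, P n.
  by have [J [t Jt]] := exJ; exists (size t); apply/asboolP; exists J, t.
case: (ex_minnP exP) => n /asboolP[J [t [Jt <-{n}]]] tmin.
exists J, t; have [sJ JS nJ TJ [tS tJ]] := Jt.
pose K i := [set psi i h | h in H `&` J].
have sHJ : subgrp (H `&` J) by exact: subgrpI.
have sK i : subgrp (K i).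
  split; first by exists 1%g => //; exact: subgrp1.
  move=> _ _ [x [Hx Jx] <-] [y [Hy Jy] <-]; exists (x * y^-1)%g.
    by apply: sHJ.2.
  by rewrite psiM ?psiV //; exact: subgrpV.
have KS i : K i `<=` S by move=> _ [x [Hx _] <-]; exact: psiS.
have nK i : normalised (K i) S.
  move=> x _ /(psi_onto i)[h Hh <-] [y [Hy Jy] <-].
  have HV : H h^-1%g by exact: subgrpV.
  exists (y ^ h)%g; last first.
    by rewrite !conjgE !psiM ?psiV //; apply: subgrpM.
  split; last by apply: nJ => //; exact: HS.
  by rewrite conjgE; do ?apply: subgrpM.
have TK i : aug_radical E (K i).
  apply: (@aug_radical_image E _ _ (H `&` J) _ (psi i)) => //.
  - by move=> x y [Hx _] [Hy _]; exact: psiM.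
  - by move=> x Xx; exists x.
  - by apply: aug_radical_sub TJ => // x [].
(* [rep y] represents the coset [J y] by an element of [H]; the value [1] stands for a coset that
   does not meet [H]. *)
pose rep y := if pselect (exists2 h, H h & J (h * y^-1)%g) is left e
              then s2val (cid2 e) else 1%g.
have repH y : H (rep y).
  by rewrite /rep; case: pselect => [e|_]; [case: cid2 | exact: subgrp1].
have repJ y h : H h -> J (h * y^-1)%g -> (H `&` J) (h * (rep y)^-1)%g.
  move=> Hh Jh; split; first exact: sH.2.
  rewrite /rep; case: pselect => [e|ne]; last by case: ne; exists h.
  case: cid2 => h' Hh' Jh' /=.
  rewrite (_ : (h * h'^-1 = (h * y^-1) * (h' * y^-1)^-1)%g); first exact: sJ.2.
  by rewrite invgF divgKA.
(* The [psi i (rep y')] with [y'] in [t] cover [S] modulo [K i]. If the part of [H] in [J y] is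
   already covered by the other entries, deleting [y] gives a shorter list, against minimality. *)
have no_smaller i y : y \in t ->
    ~ (forall k, H k -> J (k * y^-1)%g -> exists2 y', y' \in t &
        y' != y /\ K i (psi i k * (psi i (rep y'))^-1)%g).
  move=> ty small.
  suff : P (size [seq psi i (rep y') | y' <- t & y' != y]).
    move/tmin; rewrite size_map size_filter leqNgt => /negP; apply.
    rewrite -(count_predC (predC1 y) t) -[X in (X < _)%N]addn0 ltn_add2l.
    by rewrite -has_count; apply/hasP; exists y => //=; rewrite negbK.
  apply/asboolP; exists (K i); eexists; split; last by [].
  split=> //; split.
    by move=> _ /mapP[y' _ ->]; exact: psiS.
  move=> x /(psi_onto i)[k Hk <-{x}].
  have [y' ty' Jy'] := tJ k (HS Hk).
  have [yy'|yy'] := eqVneq y' y.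
    rewrite yy' in Jy'; have [z tz [zy Kz]] := small k Hk Jy'.
    by exists (psi i (rep z)) => //; apply/mapP; exists z; rewrite ?mem_filter ?zy.
  exists (psi i (rep y')); first by apply/mapP; exists y'; rewrite ?mem_filter ?yy'.
  exists (k * (rep y')^-1)%g; first exact: repJ.
  by rewrite psiM ?psiV //; exact: subgrpV.
split=> // [x Sx|i h Hh hpsi].
  (* A coset that misses [H] contributes nothing, so its entry could be deleted. *)
  apply: contrapT => nox; have [y ty Jy] := tJ x Sx.
  apply: (no_smaller i0 y ty) => k Hk Jk; case: nox; exists k => //.
  rewrite (_ : (x * k^-1 = (x * y^-1) * (k * y^-1)^-1)%g); first exact: sJ.2.
  by rewrite invgF divgKA.
(* Right multiplication by [h^-1] carries the coset [J y] of [h] to [J] without changing the value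
   of [psi i]. So the entry [y1] of the trivial coset already covers what [y] covers. *)
apply: contrapT => nJh; have [y ty Jy] := tJ h (HS Hh).
have [y1 ty1 Jy1] := tJ 1%g (subgrp1 sS).
apply: (no_smaller i y ty) => k Hk Jk; exists y1 => //; split.
  apply: contra_notN nJh => /eqP y1y; move: Jy1; rewrite y1y mul1g => Jyi.
  by rewrite -[h](mulgVK y); apply: subgrpM => //; rewrite -[y]invgK; exact: subgrpV.
have H1 := subgrp1 sH; have [] := repJ _ _ H1 Jy1; rewrite mul1g => Hr Jr.
exists (k * h^-1 * (rep y1)^-1)%g.
  apply: subgrpM => //; split; first exact: sH.2.
  rewrite (_ : (k * h^-1 = (k * y^-1) * (h * y^-1)^-1)%g); first exact: sJ.2.
  by rewrite invgF divgKA.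
have HhV : H h^-1%g by exact: subgrpV.
rewrite psiM ?(psiV _ (repH _)) ?psiM ?psiV ?hpsi ?invg1 ?mulg1 //.
exact: subgrpM.
Qed.

End MinimalRadical.

(** * Irreducible modules *)

Section MaximalStable.
Variables (V : zmodType) (ops : set (V -> V)).

(** The choice of [ops] makes these subspaces, submodules over a subgroup, or left ideals. *)
Definition stable (U : set V) :=
  [/\ U 0, forall x y, U x -> U y -> U (x - y) &
      forall s x, ops s -> U x -> U (s x)].

Lemma stableN U x : stable U -> U x -> U (- x).
Proof. by case=> U0 UB _ Ux; rewrite -[- x]sub0r; exact: UB. Qed.

Lemma stableD U x y : stable U -> U x -> U y -> U (x + y).
Proof.
by move=> sU Ux Uy; have [_ UB _] := sU; rewrite -[y]opprK; exact: UB (stableN sU _).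
Qed.

Lemma stable_sum U (T : eqType) (s : seq T) (F : T -> V) :
  stable U -> (forall i, i \in s -> U (F i)) -> U (\sum_(i <- s) F i).
Proof.
move=> sU UF; rewrite big_seq; elim/big_ind: _ => //.
  by case: sU.
by move=> x y; exact: stableD.
Qed.

Definition omits (ws : seq V) (U : set V) := exists2 w, w \in ws & ~ U w.

(** Zorn's lemma. As [ws] is finite, a non-empty chain whose union contains all of [ws] has a single
    member containing all of it, so omission passes to the union. *)
Lemma max_stable (U0 : set V) (ws : seq V) : stable U0 -> omits ws U0 ->
  exists U, [/\ stable U, U0 `<=` U, omits ws U &
    forall U', stable U' -> U `<=` U' -> omits ws U' -> U' `<=` U].
Proof.
move=> sU0 oU0.
pose P U := U = set0 \/ [/\ stable U, U0 `<=` U & omits ws U].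
have PU0 : P U0 by right; split.
have memP U x : P U -> U x -> [/\ stable U, U0 `<=` U & omits ws U].
  by case=> // ->.
have [|U [PU maxU]] := @Zorn_bigcup _ P.
  move=> F FP Ftot.
  case: (pselect (exists2 X, F X & X !=set0)) => [[X FX [x Xx]]|noX]; last first.
    left; rewrite -subset0 => x [X FX Xx]; apply: noX.
    by exists X => //; exists x.
  right; split.
  - split.
    + by exists X => //; have [[]] := memP _ _ (FP _ FX) Xx.
    + move=> y z [Y FY Yy] [Z FZ Zz].
      have [[_ YB _] _ _] := memP _ _ (FP _ FY) Yy.
      have [[_ ZB _] _ _] := memP _ _ (FP _ FZ) Zz.
      have [YZ|ZY] := Ftot _ _ FY FZ.
        by exists Z => //; apply: ZB => //; exact: (YZ _ Yy).
      by exists Y => //; apply: YB => //; exact: (ZY _ Zz).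
    + move=> s y ops_s [Y FY Yy]; exists Y => //.
      by have [[_ _ Ys] _ _] := memP _ _ (FP _ FY) Yy; exact: Ys.
  - have [_ U0X _] := memP _ _ (FP _ FX) Xx.
    by move=> y /U0X Xy; exists X.
  - apply: contrapT => noo.
    have bigU w : w \in ws -> (\bigcup_(Y in F) Y) w.
      by move=> ws_w; apply: contrapT => nw; apply: noo; exists w.
    have [Y FY [Xy Yw]] : exists2 Y, F Y & X `<=` Y /\ forall w, w \in ws -> Y w.
      elim: (ws) bigU => [_|w s IH bigU]; first by exists X; last split.
      have [|Y FY [XY Ys]] := IH.
        by move=> z sz; apply: bigU; rewrite inE sz orbT.
      have [|Z FZ Zw] := bigU w; first by rewrite inE eqxx.
      have [YZ|ZY] := Ftot _ _ FY FZ.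
        exists Z => //; split=> [|z]; first exact: subset_trans YZ.
        by rewrite inE => /predU1P[-> //|/Ys/YZ].
      exists Y => //; split=> // z.
      by rewrite inE => /predU1P[-> |/Ys //]; exact: ZY.
    have [_ _ [w /Yw + nYw]] := memP _ _ (FP _ FY) (Xy _ Xx).
    by [].
case: (PU) => [U_0|[sU U0U oU]].
  case: (maxU U0) => //; split; rewrite U_0; first exact: sub0set.
  by move=> /(_ 0); apply; case: sU0.
exists U; split=> // U' sU' UU' oU'; apply: contrapT => nU'U.
apply: (maxU U'); first by split.
by right; split=> //; exact: subset_trans UU'.
Qed.

End MaximalStable.

Section Functional.
Variables (E : fieldType) (V : zmodType) (act : E -> V -> V).
Hypothesis actDl : forall v, {morph act^~ v : c d / c + d}.
Hypothesis actDr : forall c, {morph act c : x y / x + y}.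
Hypothesis actA : forall c d v, act c (act d v) = act (c * d) v.
Hypothesis act1 : forall v, act 1 v = v.

Let act0 v : act 0 v = 0.
Proof. by apply: (addIr (act 0 v)); rewrite -actDl !add0r. Qed.
Let actr0 c : act c 0 = 0.
Proof. by apply: (addIr (act c 0)); rewrite -actDr !add0r. Qed.
Let actN c v : act (- c) v = - act c v.
Proof. by apply: (addIr (act c v)); rewrite -actDl !addNr act0. Qed.
Let actrN c v : act c (- v) = - act c v.
Proof. by apply: (addIr (act c v)); rewrite -actDr !addNr actr0. Qed.

(** A subspace maximal among those containing [U] and omitting [v] is a complement of the line
    through [v]; [mu] is the coordinate along that line. *)
Lemma exists_functional (U : set V) (v : V) :
  stable (range act) U -> ~ U v ->
  exists mu : V -> E, [/\ {morph mu : x y / x + y},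
    forall c x, mu (act c x) = c * mu x, forall x, U x -> mu x = 0 & mu v = 1].
Proof.
move=> sU nUv.
have [|U' [sU' UU' [w /[!inE]/eqP-> nU'v] maxU']] := @max_stable _ _ U [:: v] sU.
  by exists v; rewrite ?inE.
have [U'0 U'B U'a] := sU'.
have U'act c x : U' x -> U' (act c x) by apply: U'a; exists c.
have uniq_c c : U' (act c v) -> c = 0.
  move=> Ucv; have [//|c_neq0] := eqVneq c 0; case: nU'v.
  by rewrite -[v]act1 -(mulVf c_neq0) -actA; exact: U'act.
have coord y : exists c, U' (y - act c v).
  case: (pselect (U' y)) => Uy; first by exists 0; rewrite act0 subr0.
  (* [U''] is the sum of [U'] and the line of [y]. By maximality it contains [v], and the resulting
     relation is solved for [y]. *)
  pose U'' := [set z | exists c, U' (z - act c y)].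
  have : ~ (omits [:: v] U'').
    move/(maxU' U'') => sub; apply/Uy/sub.
    - split.
      + by exists 0; rewrite act0 subr0.
      + move=> a b [c Ua] [d Ub]; exists (c - d).
        by rewrite actDl actN opprD addrACA -opprD; exact: U'B.
      + move=> _ x [d _ <-] [c Ux]; exists (d * c).
        by rewrite -actA -actrN -actDr; exact: U'act.
    - by move=> z Uz; exists 0; rewrite act0 subr0.
    - by exists 1; rewrite act1 subrr.
  move=> no; have [c Uc] : U'' v.
    by apply: contrapT => nv; apply: no; exists v; rewrite ?inE.
  have [c0|c_neq0] := eqVneq c 0.
    by move: Uc; rewrite c0 act0 subr0.
  exists c^-1; rewrite -opprB; apply: (stableN sU').
  by rewrite -[y]act1 -(mulVf c_neq0) -actA -actrN -actDr; exact: U'act.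
pose mu y := projT1 (cid (coord y)).
have muP y : U' (y - act (mu y) v) by rewrite /mu; case: cid.
have muE y c : U' (y - act c v) -> mu y = c.
  move=> Uc; apply/eqP; rewrite -subr_eq0; apply/eqP/uniq_c.
  by have := U'B _ _ Uc (muP y); rewrite opprB addrC subrKA actDl actN.
exists mu; split.
- move=> x y; apply: muE.
  by rewrite actDl opprD addrACA; exact: stableD sU' (muP x) (muP y).
- by move=> c x; apply: muE; rewrite -actA -actrN -actDr; exact: U'act (muP x).
- by move=> x Ux; apply: muE; rewrite act0 subr0; exact: UU'.
- by apply: muE; rewrite act1 subrr.
Qed.

End Functional.

(** * Irreducible quotients by maximal left ideals *)

Section IrreducibleQuotient.
Variable A : nzRingType.

Lemma irreducible_set (M : lmodType A) (U : set M) : irreducible_module M ->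
  U 0 -> (forall x y, U x -> U y -> U (x + y)) -> (forall a x, U x -> U (a *: x)) ->
  (forall x, U x -> x = 0) \/ forall x, U x.
Proof.
move=> [_ irrM] U0 UD UZ.
pose P : {pred M} := fun x => `[< U x >].
have sP : submod_closed P.
  split; first exact/asboolP.
  move=> a x y /asboolP Ux /asboolP Uy; apply/asboolP; apply: UD => //; exact: UZ.
pose S : submodClosed M := HB.pack P (GRing.isSubmodClosed.Build A M P sP).
by have [h|h] := irrM S; [left=> x Ux; apply: h | right=> x; have := h x];
  first exact/asboolP; move/asboolP.
Qed.

Lemma left_quotient (M : set A) : stable (range *%R) M ->
  exists (W : lmodType A) (pi : A -> W),
    [/\ {morph pi : x y / x - y}, forall a x, pi (a * x) = a *: pi x,
        forall q, exists x, pi x = q & forall x, pi x = 0 <-> M x].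
Proof.
move=> [M0 MB Ml].
have MZ a x : M x -> M (a * x) by apply: Ml; exists a.
pose P : {pred A} := fun x => `[< M x >].
have zP : zmod_closed P.
  by split=> [|x y /asboolP Mx /asboolP My]; apply/asboolP => //; exact: MB.
pose PM : zmodClosed A := HB.pack P (GRing.isZmodClosed.Build A P zP).
pose Q := Quotient.quot PM.
pose pi : A -> Q := \pi_Q%qT.
have piE x y : pi x = pi y <-> M (x - y).
  split=> [/eqP|Mxy]; first by rewrite -Quotient.idealrBE => /asboolP.
  by apply/eqP; rewrite -Quotient.idealrBE; apply/asboolP.
have piB x y : pi (x - y) = pi x - pi y by rewrite /pi raddfB.
have piD x y : pi (x + y) = pi x + pi y by rewrite /pi raddfD.
have reprK (q : Q) : pi (repr q) = q by exact: reprK.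
pose scale a (q : Q) := pi (a * repr q).
have scaleE a x : scale a (pi x) = pi (a * x).
  by apply/piE; rewrite -mulrBr; apply/MZ/piE; rewrite reprK.
have ind (R : Q -> Prop) : (forall x, R (pi x)) -> forall q, R q.
  by move=> Rpi q; rewrite -[q]reprK.
have sA a b q : scale a (scale b q) = scale (a * b) q.
  by elim/ind: q => x; rewrite !scaleE mulrA.
have s1 : left_id 1 scale by elim/ind => x; rewrite scaleE mul1r.
have sDr : right_distributive scale +%R.
  by move=> a; elim/ind => x; elim/ind => y; rewrite -piD !scaleE mulrDr piD.
have sDl q : {morph scale^~ q : a b / a + b}.
  by move=> a b /=; elim/ind: q => x; rewrite !scaleE mulrDl piD.
pose W : lmodType A := HB.pack Q (GRing.Zmodule_isLmodule.Build A Q sA s1 sDr sDl).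
have pi_eq0 x : pi x = 0 <-> M x.
  by have := piE x 0; rewrite subr0 /pi raddf0.
by exists W, pi; split=> // q; exists (repr q).
Qed.

(** Divide by a left ideal maximal among those containing [I] and omitting [1]; the class of [1] is
    [w]. A submodule without this class pulls back to a left ideal omitting [1], hence is zero. *)
Lemma irreducible_above (I : set A) :
  stable (range *%R) I -> ~ I 1 ->
  exists W : lmodType A, irreducible_module W /\
    exists2 w : W, w != 0 & forall a, I a -> a *: w = 0.
Proof.
move=> sI nI1.
have [|M [sM IM [w /[!inE]/eqP-> nM1] maxM]] := @max_stable _ _ I [:: 1] sI.
  by exists 1; rewrite ?inE.
have [W [pi [piB piZ pi_onto pi0]]] := left_quotient sM.
exists W; split; last first.
  exists (pi 1); first by apply/eqP => /pi0.
  by move=> a Ia; rewrite -piZ mulr1; apply/pi0; exact: IM.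
split=> [|U]; first by exists (pi 1); apply/eqP => /pi0.
case: (pselect (pi 1 \in U)) => U1; [right | left] => q; have [x <-{q}] := pi_onto q.
  by rewrite -[x]mulr1 piZ rpredZ.
move=> Ux; apply/pi0; apply: (maxM [set y | pi y \in U]) => //.
- split=> [|y z /= Uy Uz|_ y [a _ <-] /= Uy].
  + by have /pi0 /= -> := let: And3 M0 _ _ := sM in M0; rewrite rpred0.
  + by rewrite piB -scaleN1r rpredD ?rpredZ.
  + by rewrite piZ rpredZ.
- by move=> y /pi0 /= ->; rewrite rpred0.
- by exists 1; rewrite ?inE.
Qed.

End IrreducibleQuotient.

(** * Irreducible modules over a group algebra *)

Section GroupAlgebraModules.
Variables (E : fieldType) (gT : groupType).
Local Notation A := (grpalg E gT).

Lemma monomialE (c : E) (g : gT) : << c *g g >> = c%:A * gelt E g :> A.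
Proof.
rewrite -scalerAl mul1r; apply/malgP => k.
by rewrite mcoeffZ !mcoeffU mulrnAr mulr1.
Qed.

Lemma grpalgE (a : A) : a = \sum_(g <- msupp a) (a@_g)%:A * gelt E g.
Proof. by rewrite {1}[a]monalgE; apply: eq_bigr => g _; rewrite monomialE. Qed.

Lemma scalar_gelt (c : E) (g : gT) : c%:A * gelt E g = gelt E g * c%:A :> A.
Proof.
have -> : (c%:A : A) = << c *g 1%g >>.
  by apply/malgP => k; rewrite mcoeffZ !mcoeffU mulrnAr mulr1.
by rewrite [LHS]grpalg_mulUU [RHS]grpalg_mulUU mulr1 mul1r mulg1 mul1g.
Qed.

Variable M : lmodType A.
Implicit Types (v w : M) (U : set M).

Definition smul (c : E) v := (c%:A : A) *: v.
Definition gact (g : gT) v := gelt E g *: v.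

Lemma smulDl v : {morph smul^~ v : c d / c + d}.
Proof. by move=> c d; rewrite /smul scalerDl scalerDl. Qed.
Lemma smulDr c : {morph smul c : v w / v + w}.
Proof. by move=> v w; rewrite /smul scalerDr. Qed.
Lemma smulA c d v : smul c (smul d v) = smul (c * d) v.
Proof. by rewrite /smul scalerA -scalerAl mul1r scalerA. Qed.
Lemma smul1 v : smul 1 v = v.
Proof. by rewrite /smul scale1r scale1r. Qed.
Lemma gactM g h v : gact (g * h)%g v = gact g (gact h v).
Proof. by rewrite /gact geltM scalerA. Qed.
Lemma gact1 v : gact 1%g v = v.
Proof. by rewrite /gact gelt1 scale1r. Qed.
Lemma gactB g : {morph gact g : v w / v - w}.
Proof. by move=> v w; rewrite /gact scalerBr. Qed.
Lemma gactZ g c v : gact g (smul c v) = smul c (gact g v).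
Proof. by rewrite /gact /smul !scalerA scalar_gelt. Qed.
Lemma gactE a v : a *: v = \sum_(g <- msupp a) smul a@_g (gact g v).
Proof.
rewrite {1}[a]grpalgE scaler_suml; apply: eq_bigr => g _.
by rewrite -scalerA.
Qed.

Lemma submodule_dichotomy U : irreducible_module M ->
  U 0 -> (forall v w, U v -> U w -> U (v - w)) ->
  (forall c v, U v -> U (smul c v)) -> (forall g v, U v -> U (gact g v)) ->
  (forall v, U v -> v = 0) \/ forall v, U v.
Proof.
move=> irrM U0 UB Uc Ug.
have sU : stable [set gact g | g in setT] U.
  by split=> // _ v [g _ <-]; exact: Ug.
apply: irreducible_set => // [v w Uv Uw|a v Uv]; first exact: stableD sU Uv Uw.
by rewrite gactE; apply: stable_sum sU _ => g _; exact/Uc/Ug.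
Qed.

(** [U] is only a subspace containing the orbit of [w]: irreducibility makes [w] a generator, so
    every vector is a linear combination of its translates. *)
Lemma cyclic_all U w : irreducible_module M -> w != 0 ->
  U 0 -> (forall v w, U v -> U w -> U (v - w)) ->
  (forall c v, U v -> U (smul c v)) -> (forall g, U (gact g w)) -> forall v, U v.
Proof.
move=> irrM w0 U0 UB Uc Ug v.
pose Aw := range (fun a : A => a *: w).
have Aw0 : Aw 0 by exists 0; rewrite ?scale0r.
have AwD x y : Aw x -> Aw y -> Aw (x + y).
  by move=> [a _ <-] [b _ <-]; exists (a + b); rewrite ?scalerDl.
have AwZ a x : Aw x -> Aw (a *: x).
  by move=> [b _ <-]; exists (a * b); rewrite ?scalerA.
have [h|h] := irreducible_set irrM Aw0 AwD AwZ.
  by case/eqP: w0; apply: h; exists 1; rewrite ?scale1r.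
have [a _ <-] := h v; rewrite gactE.
have sU : stable set0 U by split=> // s ? [].
by apply: stable_sum sU _ => g _; exact/Uc/Ug.
Qed.

(* [M] is finitely generated over [J], hence has a maximal proper             *)
(* [J]-submodule U. If [r] in [J] acted non-trivially on the simple module    *)
(* M / U, a matrix coefficient of M / U would contradict [aug_radical E J].   *)
(* The largest [gT]-submodule of U is zero and contains (r - 1) M.            *)
Lemma aug_radical_trivial (J : set gT) (t : seq gT) : irreducible_module M ->
  subgrp J -> normalised J setT -> aug_radical E J -> covers J setT t ->
  forall r v, J r -> gact r v = v.
Proof.
move=> irrM sJ nJ TJ [_ tJ].
have [[w w0] _] := irrM.
pose ws := [seq gact y w | y <- t].
pose ops := range smul `|` [set gact j | j in J].
have s0 : stable ops [set 0].
  split=> // [_ _ -> ->|_ _ [[c _ <-]|[j _ <-]] ->]; first by rewrite /= subr0.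
    by rewrite /= /smul scaler0.
  by rewrite /= /gact scaler0.
have [|U [sU _ [u0 _ nUu0] maxU]] := @max_stable _ ops [set 0] ws s0.
  have [y ty _] := tJ 1%g I; exists (gact y w); first by apply/mapP; exists y.
  move/(congr1 (gact y^-1%g)); rewrite -gactM mulVg gact1 /gact scaler0.
  by move/eqP; rewrite (negPf w0).
have [U0 UB Uops] := sU.
have opsc c : ops (smul c) by left; exists c.
have opsj j : J j -> ops (gact j) by right; exists j.
(* Every [g] lies in some [J y] with [y] in [t], so a [J]-stable subspace containing [ws] contains
   the orbit of [w]. *)
have all_of U' v : stable ops U' -> ~ omits ws U' -> U' v.
  move=> [U'0 U'B U'ops] noo; apply: (@cyclic_all _ w) => //.
    by move=> c x; exact: U'ops (opsc c).
  move=> g; have [y ty Jy] := tJ g I.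
  rewrite -[g](mulgVK y) gactM; apply: (U'ops _ _ (opsj _ Jy)).
  apply: contrapT => nU; apply: noo; exists (gact y w) => //.
  by apply/mapP; exists y.
have augU r v : J r -> U (gact r v - v).
  move=> Jr; apply: contrapT; set y := gact r v - v => nUy.
  pose lin (b : seq (E * gT)) x := \sum_(ch <- b) smul ch.1 (gact ch.2 x).
  pose inJ (b : seq (E * gT)) := forall ch, ch \in b -> J ch.2.
  (* [U'] is [U + E[J] y] and contains [y], which is not in [U]. By maximality of [U] it contains
     all of [ws], so it is everything. *)
  pose U' := [set z | exists2 b, inJ b & U (z - lin b y)].
  have lin_cat b c x : lin (b ++ c) x = lin b x + lin c x by rewrite /lin big_cat.
  have lin_smul d b x : lin [seq (d * ch.1, ch.2) | ch <- b] x = smul d (lin b x).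
    rewrite /lin big_map (big_morph (smul d) (smulDr d) (scaler0 _ _)).
    by apply: eq_bigr => ch _; rewrite -smulA.
  have lin_gact g b x : lin [seq (ch.1, g * ch.2)%g | ch <- b] x = gact g (lin b x).
    rewrite /lin big_map (big_morph (gact g) (scalerDr _) (scaler0 _ _)).
    by apply: eq_bigr => ch _; rewrite gactZ -gactM.
  have sU' : stable ops U'.
    split=> [|z1 z2 [b Jb Uz1] [c Jc Uz2]|_ z [[d _ <-]|[j Jj <-]] [b Jb Uz]].
    - by exists [::] => //; rewrite /lin big_nil subr0.
    - exists (b ++ [seq (- 1 * ch.1, ch.2) | ch <- c]).
        by move=> ch; rewrite mem_cat => /orP[/Jb //|/mapP[dh /Jc Jh ->]].
      rewrite lin_cat lin_smul /smul !scaleN1r opprD addrACA -opprD.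
      exact: UB.
    - exists [seq (d * ch.1, ch.2) | ch <- b]; first by move=> ch /mapP[dh /Jb Jh ->].
      by rewrite lin_smul /smul -scalerBr; exact: Uops (opsc d) Uz.
    - exists [seq (ch.1, j * ch.2)%g | ch <- b].
        by move=> ch /mapP[dh /Jb Jh ->]; exact: subgrpM.
      by rewrite lin_gact -gactB; exact: Uops (opsj j Jj) Uz.
  have [b Jb Ub] : U' v.
    apply: all_of => // o; apply: nUy; apply: (maxU U') => //.
      by move=> z Uz; exists [::] => //; rewrite /lin big_nil subr0.
    exists [:: (1, 1%g)]; first by move=> ch /[!inE]/eqP->; exact: subgrp1.
    by rewrite /lin big_seq1 smul1 gact1 subrr.
  have nUv : ~ U v.
    by move=> Uv; apply: nUy; apply: UB => //; exact: Uops (opsj r Jr) Uv.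
  have sUc : stable (range smul) U.
    by split=> // _ x [c _ <-]; exact: Uops (opsc c).
  have [mu [muD muZ muU muv]] :=
    exists_functional smulDl smulDr smulA smul1 sUc nUv.
  have mu0 : mu 0 = 0 by exact: muU.
  have muB x z : mu (x - z) = mu x - mu z.
    by apply/eqP; rewrite eq_sym subr_eq -muD subrK.
  (* Modulo [U], [v] is congruent to [b (r - 1) v], so the matrix coefficient [x |-> mu (x v)]
     satisfies the relation in [TJ] and must vanish, contrary to [mu v = 1]. *)
  have /eqP : mu (gact 1%g v) = 0.
    apply: (TJ r b (fun x => mu (gact x v)) Jr Jb); last exact: subgrp1.
    move=> x Jx; rewrite -{1}[v](subrK (lin b y)) /gact scalerDr muD.
    rewrite [X in X + _]muU ?add0r; last exact: Uops (opsj x Jx) Ub.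
    rewrite -/(gact x _) -lin_gact /lin (big_morph mu muD mu0) big_map.
    apply: eq_bigr => ch _; rewrite muZ /y gactB muB -/(gact _ v) -/(gact _ v).
    by rewrite -!gactM.
  by rewrite gact1 muv oner_eq0.
have [||||D0|Dall] := @submodule_dichotomy [set v | forall g, U (gact g v)] irrM.
- by move=> g; rewrite /gact scaler0.
- by move=> v v' Dv Dv' g; rewrite gactB; exact: UB.
- by move=> c v Dv g; rewrite gactZ; exact: Uops (opsc c) (Dv g).
- by move=> h v Dv g; rewrite -gactM; exact: Dv.
- move=> r v Jr; apply/eqP; rewrite -subr_eq0; apply/eqP/D0 => g.
  have Jrg : J (g * r * g^-1)%g.
    by have := nJ g^-1%g r I Jr; rewrite conjgE invgK mulgA.
  by rewrite gactB -gactM -[(g * r)%g](mulgVK g) gactM; exact: augU.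
- by case: nUu0; have := Dall u0 1%g; rewrite gact1.
Qed.

(** In characteristic [p], [(b - 1)^p = b^p - 1 = 0]. The fixed vectors of [b] form a submodule
    because [b] commutes with the action; were it zero, [b - 1] would be both injective and
    nilpotent. *)
Lemma central_unipotent (p : nat) (b : gT) : p \in [pchar E] ->
  irreducible_module M -> (b ^+ p = 1)%g ->
  (forall g v, gact g (gact b v) = gact b (gact g v)) ->
  forall v, gact b v = v.
Proof.
move=> pE irrM bp bC.
have [||||D0|//] := @submodule_dichotomy [set v | gact b v = v] irrM.
- by rewrite /= /gact scaler0.
- by move=> v w /= bv bw; rewrite gactB bv bw.
- by move=> c v /= bv; rewrite gactZ bv.
- by move=> g v /= bv; rewrite -bC bv.
have pA : p \in [pchar A].
  have [p_prime /eqP p0] := andP pE.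
  apply/andP; split=> //; apply/eqP.
  by rewrite -[1]scale1r scalerMnl p0 scale0r.
have xp : (gelt E b - 1 : A) ^+ p = 0.
  rewrite -(pFrobenius_autE pA) pFrobenius_autB_comm; last exact: commr1.
  rewrite !pFrobenius_autE expr1n (_ : gelt E b ^+ p = gelt E (b ^+ p)%g).
    by rewrite bp gelt1 subrr.
  elim: (p) => [|n IH]; first by rewrite expr0 expg0 gelt1.
  by rewrite exprS IH expgS geltM.
have [[w w0] _] := irrM.
have : (gelt E b - 1 : A) ^+ p *: w != 0.
  elim: (p) => [|n IH]; first by rewrite expr0 scale1r.
  apply: contraNneq IH; rewrite exprS -scalerA scalerBl scale1r => /subr0_eq h.
  by apply/eqP/D0.
by rewrite xp scale0r eqxx.
Qed.

Lemma trivial_action_module : irreducible_module M ->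
  (forall g v, gact g v = v) -> trivial_module M.
Proof.
move=> irrM act1; split=> //; have [[w w0] _] := irrM; exists w => // v.
apply: (@cyclic_all [set v | exists c, v = smul c w] w) => //.
- by exists 0; rewrite /smul !scale0r.
- move=> _ _ [c ->] [d ->]; exists (c - d).
  by rewrite /smul -scalerBl -scalerBl.
- by move=> c _ [d ->]; exists (c * d); rewrite smulA.
- by move=> g; exists 1; rewrite act1 smul1.
Qed.

(** Once [J] acts trivially, the elements of [B] act by commuting operators of order dividing [p].
    They are then central, hence trivial, and [J] and [B] generate the group. *)
Lemma only_trivial_module (p : nat) (J B : set gT) (t : seq gT) :
  p \in [pchar E] -> irreducible_module M ->
  subgrp J -> normalised J setT -> aug_radical E J -> covers J setT t ->
  (forall b, B b -> b ^+ p = 1)%g ->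
  (forall b c, B b -> B c -> J (b * c * (c * b)^-1)%g) ->
  (forall X, subgrp X -> J `<=` X -> B `<=` X -> forall x, X x) ->
  trivial_module M.
Proof.
move=> pE irrM sJ nJ TJ tJ Bp BC genJB.
have J1 r v : J r -> gact r v = v := aug_radical_trivial irrM sJ nJ TJ tJ v.
apply: trivial_action_module => // g v.
pose X := [set g | forall v, gact g v = v].
have sX : subgrp X.
  split=> [|x y Xx Xy] u; first exact: gact1.
  have yVu : gact y^-1%g u = u by rewrite -{1}(Xy u) -gactM mulVg gact1.
  by rewrite gactM yVu Xx.
apply: (genJB X) => // [r Jr u|b Bb]; first exact: J1.
apply: central_unipotent pE irrM (Bp _ Bb) _ => x.
pose Y := [set g | forall v, gact g (gact b v) = gact b (gact g v)].
apply: (genJB Y).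
- split=> [u|y z Yy Yz u]; first by rewrite !gact1.
  have zVb : gact z^-1%g (gact b u) = gact b (gact z^-1%g u).
    by rewrite -{1}(gact1 u) -(mulgV z) gactM -Yz -gactM mulVg gact1.
  by rewrite !gactM zVb Yy.
- by move=> r Jr u; rewrite !(J1 r).
- move=> c Bc u; rewrite -!gactM -[(c * b)%g](mulgVK (b * c)%g) gactM.
  by rewrite (J1 _ _ (BC _ _ Bc Bb)).
Qed.

End GroupAlgebraModules.

(** * From arbitrarily many to infinitely many isomorphism classes *)

Section IsomorphismClasses.
Variable A : nzRingType.
Implicit Types M N P : lmodType A.

Lemma module_iso_sym M N : module_iso M N -> module_iso N M.
Proof.
move=> [f [g fK gK]].
have gP : linear g.
  by move=> a x y; apply: (can_inj fK); rewrite linearP !gK.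
pose g' : {linear N -> M} := HB.pack g (GRing.isLinear.Build A N M *:%R g gP).
by exists g', f.
Qed.

Lemma module_iso_trans M N P : module_iso M N -> module_iso N P -> module_iso M P.
Proof. by move=> [f fb] [g gb]; exists (g \o f); exact: bij_comp. Qed.

Definition arbitrarily_many_irreducibles := forall n, exists M : 'I_n -> lmodType A,
  (forall i, irreducible_module (M i)) /\
  (forall i j : 'I_n, (i < j)%N -> ~ module_iso (M i) (M j)).

(** Among [n.+1] pairwise non-isomorphic modules, the pigeonhole principle yields one isomorphic to
    none of [n] given modules, so a sequence can be chosen recursively. *)
Lemma infinitely_many_irreducibles : arbitrarily_many_irreducibles ->
  exists M : nat -> lmodType A, (forall i, irreducible_module (M i)) /\
    (forall i j, i <> j -> ~ module_iso (M i) (M j)).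
Proof.
move=> many.
have fresh n (L : nat -> lmodType A) : exists W, irreducible_module W /\
    forall i, (i < n)%N -> ~ module_iso (L i) W.
  have [M [irrM nisoM]] := many n.+1; apply: contrapT => nofresh.
  have hit k : exists i : 'I_n, module_iso (L i) (M k).
    apply: contrapT => nohit; apply: nofresh; exists (M k); split=> // i lt_in iso_i.
    by apply: nohit; exists (Ordinal lt_in).
  pose phi k := projT1 (cid (hit k)).
  have phiP k : module_iso (L (phi k)) (M k) by rewrite /phi; case: cid.
  have phi_lt (i j : 'I_n.+1) : (i < j)%N -> phi i <> phi j.
    move=> ij phi_ij; apply: (nisoM i j ij).
    apply: module_iso_trans (module_iso_sym (phiP i)) _.
    by rewrite phi_ij; exact: phiP.
  have /leq_card : injective phi.
    move=> i j phi_ij; apply/val_inj.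
    by case: (ltngtP i j) => // /phi_lt; rewrite phi_ij.
  by rewrite !card_ord ltnn.
pose nxt (l : seq (lmodType A)) :=
  projT1 (cid (fresh (size l) (nth (A^o : lmodType A) l))).
have nxtP l : irreducible_module (nxt l) /\
    forall i, (i < size l)%N -> ~ module_iso (nth (A^o : lmodType A) l i) (nxt l).
  by rewrite /nxt; case: cid.
pose pre n := iter n (fun l => rcons l (nxt l)) [::].
have size_pre n : size (pre n) = n.
  by elim: n => //= n IH; rewrite size_rcons IH.
have nth_pre i n : (i < n)%N -> nth (A^o : lmodType A) (pre n) i = nxt (pre i).
  elim: n => //= n IH; rewrite ltnS nth_rcons size_pre => le_in.
  by case: ltngtP le_in => [/IH ->|//|-> _].
have niso i j : (i < j)%N -> ~ module_iso (nxt (pre i)) (nxt (pre j)).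
  move=> ij; have [_ /(_ i)] := nxtP (pre j).
  by rewrite size_pre nth_pre // => /(_ ij).
exists (fun n => nxt (pre n)); split=> [i|i j /eqP]; first by have [] := nxtP (pre i).
by rewrite neq_ltn => /orP[/niso //|/niso h /module_iso_sym].
Qed.

End IsomorphismClasses.

(** * Irreducible modules from a commuting family of subgroups *)

Section CommutingFamily.
Variables (E : fieldType) (gT : groupType) (I : finType).
Variables (R : I -> set gT) (sigma : gT -> I -> I).
Hypothesis R_comm : forall i j r s, i != j -> R i r -> R j s -> (r * s = s * r)%g.
Hypothesis sigma_inj : forall g, injective (sigma g).
Hypothesis R_conj : forall g i r, R i r -> R (sigma g i) (r ^ g)%g.
Local Notation A := (grpalg E gT).

(** The group algebra acts on functions from the left through right translations; this is the value
    at [x] of [a] applied to [f]. *)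
Definition feval (f : gT -> E) (a : A) (x : gT) : E :=
  \sum_(g <- msupp a) a@_g * f (x * g)%g.

Lemma fevalEw f (a : A) (d : {fset gT}) x : (msupp a `<=` d)%fset ->
  feval f a x = \sum_(g <- d) a@_g * f (x * g)%g.
Proof.
move=> le_d; rewrite /feval (big_fset_incl _ le_d) //= => g _ /mcoeff_outdom ->.
by rewrite mul0r.
Qed.

Lemma fevalB f (a b : A) x : feval f (a - b) x = feval f a x - feval f b x.
Proof.
rewrite (@fevalEw _ (a - b) (msupp a `|` msupp b)%fset) ?msuppB_le //.
rewrite (@fevalEw _ a (msupp a `|` msupp b)%fset) ?fsubsetUl //.
rewrite (@fevalEw _ b (msupp a `|` msupp b)%fset) ?fsubsetUr //.
by rewrite -sumrB; apply: eq_bigr => g _; rewrite mcoeffB mulrBl.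
Qed.

Lemma feval0 f x : feval f 0 x = 0.
Proof. by rewrite /feval msupp0 big_seq_fset0. Qed.

Lemma fevalD f (a b : A) x : feval f (a + b) x = feval f a x + feval f b x.
Proof.
have -> : a + b = a - (0 - b) by rewrite sub0r opprK.
by rewrite !fevalB feval0 sub0r opprK.
Qed.

Lemma fevalU f c g x : feval f << c *g g >> x = c * f (x * g)%g.
Proof. by rewrite (fevalEw _ _ msuppU_le) big_seq_fset1 mcoeffUU. Qed.

Lemma feval_sum f (T : Type) (s : seq T) (F : T -> A) x :
  feval f (\sum_(i <- s) F i) x = \sum_(i <- s) feval f (F i) x.
Proof.
exact: (big_morph (fun a => feval f a x) (fun a b => fevalD f a b x) (feval0 f x)).
Qed.

Lemma fevalUM f c g (a : A) x :
  feval f ((<< c *g g >> : A) * a) x = c * feval f a (x * g)%g.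
Proof.
rewrite [X in _ * X]monalgE mulr_sumr feval_sum /feval mulr_sumr.
apply: eq_bigr => h _; rewrite mulrA -mulgA -fevalU; congr feval.
exact: grpalg_mulUU.
Qed.

(** The annihilator of [f] is a left ideal, proper because [f 1] is non-zero; [W] is an irreducible
    quotient of the module generated by [f]. *)
Lemma module_of_function (f : gT -> E) : f 1%g != 0 ->
  exists W : lmodType A, irreducible_module W /\
    exists2 w : W, w != 0 & forall a, (forall x, feval f a x = 0) -> a *: w = 0.
Proof.
move=> f1; apply: (@irreducible_above _ [set a : A | forall x, feval f a x = 0]).
  split=> [x|a b Ia Ib x|_ b [a _ <-] Ib x]; first exact: feval0.
    by rewrite fevalB Ia Ib subr0.
  rewrite [a]monalgE mulr_suml feval_sum big1 // => g _.
  by rewrite fevalUM Ib mulr0.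
by move/(_ 1%g)/eqP; rewrite fevalU mul1r mulg1 (negPf f1).
Qed.

Definition aug (r : gT) : A := gelt E r - 1.
Definition augs (s : seq (I * gT)) : A := \prod_(q <- s) aug q.2.
Definition selection (s : seq (I * gT)) :=
  uniq [seq q.1 | q <- s] /\ forall q, q \in s -> R q.1 q.2.

(* Distinguishes the modules [module_of_support] obtained from sets [K] of    *)
(* different cardinals.                                                       *)
Definition killed (k : nat) (W : lmodType A) := forall (s : seq (I * gT)) (w : W),
  selection s -> size s = k -> augs s *: w = 0.

Lemma killed_iso k (M N : lmodType A) : module_iso M N -> killed k M -> killed k N.
Proof.
move=> [f [g fK gK]] kM s w sel_s size_s.
by rewrite -[w]gK -linearZ (kM s (g w)) // linear0.
Qed.

Lemma aug_comm i j r s : i != j -> R i r -> R j s -> GRing.comm (gelt E r) (aug s).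
Proof.
move=> ij Rr Rs; apply: commrB; last exact: commr1.
by rewrite /GRing.comm -!geltM (R_comm ij Rr Rs).
Qed.

Lemma gelt_augs_comm i r (s : seq (I * gT)) : R i r -> i \notin [seq q.1 | q <- s] ->
  (forall q, q \in s -> R q.1 q.2) -> GRing.comm (gelt E r) (augs s).
Proof.
move=> Rr; elim: s => [|q s IH] /=; first by rewrite /augs big_nil => *; exact: commr1.
rewrite inE negb_or => /andP[iq is_] Rs.
rewrite /augs big_cons; apply: commrM.
  by apply: (aug_comm iq Rr); apply: Rs; rewrite inE eqxx.
by apply: IH => // t ts; apply: Rs; rewrite inE ts orbT.
Qed.

Lemma scalar_comm (c : E) (a : A) : GRing.comm c%:A a.
Proof.
have cd (d : E) : GRing.comm (c%:A : A) d%:A.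
  by rewrite /GRing.comm -!scalerAl !mul1r !scalerA mulrC.
have cg g : GRing.comm (c%:A : A) (gelt E g) by exact: scalar_gelt.
by rewrite [a]grpalgE; apply: commr_sum => g _; exact: commrM.
Qed.

Definition conj_sel g (s : seq (I * gT)) := [seq (sigma g q.1, q.2 ^ g)%g | q <- s].

Lemma augs_gelt g s : augs s * gelt E g = gelt E g * augs (conj_sel g s).
Proof.
elim: s => [|q s IH]; first by rewrite /augs !big_nil mulr1 mul1r.
rewrite /augs !big_cons -mulrA -/(augs s) IH !mulrA; congr (_ * _).
by rewrite /aug mulrBl mulrBr mulr1 mul1r -!geltM -conjgC.
Qed.

Lemma selection_conj g s : selection s -> selection (conj_sel g s).
Proof.
move=> [us Rs]; split; last by move=> _ /mapP[q /Rs Rq ->]; exact: R_conj.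
rewrite -map_comp (_ : [seq _ | q <- s] = [seq sigma g i | i <- [seq q.1 | q <- s]]).
  by rewrite map_inj_uniq //; exact: sigma_inj.
by rewrite -map_comp.
Qed.

Definition faug (b : seq (E * gT)) (r : gT) : A :=
  (\sum_(ch <- b) ch.1%:A * gelt E ch.2) * aug r.

Lemma feval_faug f b r x : feval f (faug b r) x =
  \sum_(ch <- b) ch.1 * (f (x * ch.2 * r)%g - f (x * ch.2)%g).
Proof.
rewrite /faug mulr_suml feval_sum; apply: eq_bigr => ch _.
by rewrite -monomialE fevalUM /aug fevalB !fevalU mulg1 !mul1r.
Qed.

Lemma faug_augs_comm i r b (s : seq (I * gT)) :
  R i r -> (forall ch, ch \in b -> R i ch.2) -> i \notin [seq q.1 | q <- s] ->
  (forall q, q \in s -> R q.1 q.2) -> GRing.comm (augs s) (faug b r).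
Proof.
move=> Rr Rb is_ Rs; apply: commrM.
  rewrite big_seq; apply: commr_sum => ch /Rb Rh.
  by apply: commrM; apply: commr_sym; [exact: scalar_comm | exact: gelt_augs_comm Rh is_ Rs].
by apply: commrB; [apply: commr_sym; exact: gelt_augs_comm Rr is_ Rs | exact: commr1].
Qed.

(** A left multiple [faug b q.2] of the first factor fixes [w] and commutes with the remaining
    factors. If the full product killed [w], so would the product without its first factor. *)
Lemma augs_neq0 (W : lmodType A) (w : W) (s : seq (I * gT)) : w != 0 -> selection s ->
  (forall q, q \in s -> exists2 b,
    forall ch, ch \in b -> R q.1 ch.2 & faug b q.2 *: w = w) ->
  augs s *: w != 0.
Proof.
move=> w0; elim: s => [|q s IH] [/= us Rs] hs.
  by rewrite /augs big_nil scale1r.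
have [q_s uniq_s] := andP us.
have Rs' t : t \in s -> R t.1 t.2 by move=> ts; apply: Rs; rewrite inE ts orbT.
have [b Rb bw] := hs q (mem_head _ _).
apply: contraNneq (IH (conj uniq_s Rs') _) => [|t ts]; last first.
  by apply: hs; rewrite inE ts orbT.
rewrite /augs big_cons -scalerA -/(augs s) => sw.
have Rq : R q.1 q.2 by apply: Rs; rewrite mem_head.
rewrite -{1}bw scalerA (faug_augs_comm Rq Rb q_s Rs') -scalerA /faug -scalerA sw.
by rewrite scaler0.
Qed.

(** For [i] in [K], [f] equals [b (r - 1) f], so some product of [#|K|] factors does not kill the
    image [w] of [f]. A longer selection has an index [i] outside [K], where [R i] fixes [w]. *)
Lemma module_of_support (K : {set I}) (f : gT -> E) : f 1%g != 0 ->
  (forall i r x, i \notin K -> R i r -> f (x * r)%g = f x) ->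
  (forall i, i \in K -> exists r b, [/\ R i r, forall ch, ch \in b -> R i ch.2 &
     forall x, f x = \sum_(ch <- b) ch.1 * (f (x * ch.2 * r)%g - f (x * ch.2)%g)]) ->
  exists W : lmodType A, [/\ irreducible_module W, ~ killed #|K| W &
    forall k, (#|K| < k)%N -> killed k W].
Proof.
move=> f1 fK fnK.
have [W [irrW [w w0 annw]]] := module_of_function f1.
exists W; split=> // [kK|k Kk].
  have {}fnK i : exists q : gT * seq (E * gT), i \in K -> [/\ R i q.1,
      forall ch, ch \in q.2 -> R i ch.2 & faug q.2 q.1 *: w = w].
    case: (boolP (i \in K)) => [/fnK[r [b [Rr Rb fE]]]|_]; last first.
      by exists (1%g, [::]).
    exists (r, b) => _; split=> //=; apply/eqP; rewrite -subr_eq0 -[X in _ - X]scale1r.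
    rewrite -scalerBl; apply/eqP/annw => x; rewrite fevalB feval_faug -fE.
    by rewrite fevalU mulg1 mul1r subrr.
  pose q i := projT1 (cid (fnK i)).
  have qP i : i \in K -> [/\ R i (q i).1,
      forall ch, ch \in (q i).2 -> R i ch.2 & faug (q i).2 (q i).1 *: w = w].
    by rewrite /q; case: cid.
  pose s := [seq (i, (q i).1) | i <- enum K].
  have sel_s : selection s.
    split; first by rewrite -map_comp map_id_in ?enum_uniq.
    by move=> _ /mapP[i + ->]; rewrite mem_enum => /qP[].
  have s_K : size s = #|K| by rewrite size_map -cardE.
  have := augs_neq0 w0 sel_s; rewrite (kK _ _ sel_s s_K) eqxx => h.
  apply/notF/h => _ /mapP[i + ->]; rewrite mem_enum => /qP[_ Rb bw].
  by exists (q i).2.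
move=> s v; move: s.
apply: (@cyclic_all _ _ _ [set v | forall s, selection s -> size s = k -> augs s *: v = 0] w) => //.
- by move=> s _ _; rewrite scaler0.
- by move=> x y /= Dx Dy s ss sk; rewrite scalerBr Dx ?Dy ?subr0.
- move=> c x /= Dx s ss sk; rewrite /smul scalerA -scalar_comm -scalerA Dx //.
  by rewrite scaler0.
(* Moving [g] to the left replaces the selection by a conjugate one of the same size, so only [w]
   itself has to be treated. *)
move=> g s /(selection_conj g) + sk; rewrite /gact scalerA augs_gelt -scalerA.
have : size (conj_sel g s) = k by rewrite size_map.
move: (conj_sel g s) => {sk}s sk [us Rs].
have [q qs qK] : exists2 q, q \in s & q.1 \notin K.
  apply: contrapT => noq; move: Kk; rewrite -sk ltnNge => /negP; apply.
  rewrite -(size_map (@fst I gT)) -(card_uniqP us); apply/subset_leq_card/fintype.subsetP.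
  by move=> _ /mapP[q qs ->]; apply: contrapT => /negP qK; apply: noq; exists q.
have augw : aug q.2 *: w = 0.
  apply: annw => x; rewrite fevalB !fevalU mulg1 !mul1r.
  by rewrite (fK q.1) ?subrr //; exact: Rs.
case/splitPr: {s sk}qs us Rs => s1 s2; rewrite map_cat cat_uniq /= => /and3P[_ _ /andP[q2 _]] Rs.
have Rq : R q.1 q.2 by apply: Rs; rewrite mem_cat inE eqxx orbT.
have Rs2 t : t \in s2 -> R t.1 t.2 by move=> ts; apply: Rs; rewrite mem_cat inE ts !orbT.
rewrite /augs big_cat big_cons -/(augs s2) /=.
have -> : aug q.2 * augs s2 = augs s2 * aug q.2.
  apply: commr_sym; apply: commrB; last exact: commr1.
  by apply: commr_sym; exact: gelt_augs_comm Rq q2 Rs2.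
by rewrite -!scalerA augw !scaler0.
Qed.

(** One set [K] is taken for each cardinal [k < #|I|]. For [k < l], [killed l] holds for the [k]-th
    module and fails for the [l]-th. *)
Lemma many_irreducibles :
  (forall K : {set I}, exists f : gT -> E, [/\ f 1%g != 0,
    forall i r x, i \notin K -> R i r -> f (x * r)%g = f x &
    forall i, i \in K -> exists r b, [/\ R i r, forall ch, ch \in b -> R i ch.2 &
     forall x, f x = \sum_(ch <- b) ch.1 * (f (x * ch.2 * r)%g - f (x * ch.2)%g)]]) ->
  exists M : 'I_#|I| -> lmodType A, (forall i, irreducible_module (M i)) /\
    (forall i j : 'I_#|I|, (i < j)%N -> ~ module_iso (M i) (M j)).
Proof.
move=> exf.
have exW (k : 'I_#|I|) : exists W : lmodType A, [/\ irreducible_module W, ~ killed k W &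
    forall l, (k < l)%N -> killed l W].
  pose K := [set i in take k (enum I)].
  have cardK : #|K| = k.
    rewrite cardsE (card_uniqP _) ?take_uniq ?enum_uniq // size_takel //.
    by rewrite -cardE; exact: ltnW.
  by have [f [f1 fK fnK]] := exf K; rewrite -cardK; exact: module_of_support f1 fK fnK.
pose M k := projT1 (cid (exW k)).
have MP k : [/\ irreducible_module (M k), ~ killed k (M k) &
    forall l, (k < l)%N -> killed l (M k)] by rewrite /M; case: cid.
exists M; split=> [k|k l kl iso]; first by have [] := MP k.
have [_ _ kM] := MP k; have [_ nkM _] := MP l.
by apply: nkM; apply: killed_iso iso _; exact: kM.
Qed.

End CommutingFamily.

(** * Sections of tree automorphisms *)

Section Sections.
Variable p : nat.
Implicit Types (g h s l : aut p) (u v w : vertex p).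

Lemma autM g h w : (g * h)%g w = h (g w). Proof. by []. Qed.
Lemma aut1 w : (1%g : aut p) w = w. Proof. by []. Qed.
Lemma autK g w : (g^-1)%g (g w) = w. Proof. exact: aut_invK. Qed.
Lemma autVK g w : g ((g^-1)%g w) = w. Proof. exact: aut_invVK. Qed.
Lemma autJ g h w : (g ^ h)%g w = h (g ((h^-1)%g w)). Proof. by []. Qed.

Lemma size_aut g w : size (g w) = size w.
Proof.
elim/last_ind: w => [|w x IH]; first by rewrite aut_nil.
by have [y ->] := aut_rcons g w x; rewrite !size_rcons IH.
Qed.

Definition sec_fun u g w := drop (size u) (g (u ++ w)).

Lemma sec_funE u g w : g (u ++ w) = g u ++ sec_fun u g w.
Proof.
suff [w' E] : exists w', g (u ++ w) = g u ++ w'.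
  by rewrite /sec_fun E drop_size_cat ?size_aut.
elim/last_ind: w => [|w x [w' E]]; first by exists [::]; rewrite !cats0.
by rewrite -rcons_cat; have [y ->] := aut_rcons g (u ++ w) x; exists (rcons w' y);
  rewrite E rcons_cat.
Qed.

Lemma edge_sec u g v w : edge v w -> edge (sec_fun u g v) (sec_fun u g w).
Proof.
move=> /edgeP[x ->]; apply/edgeP.
have [y E] := aut_rcons g (u ++ v) x; exists y.
by rewrite /sec_fun -rcons_cat E drop_rcons // size_aut size_cat leq_addr.
Qed.

Lemma sec_funK u g : cancel (sec_fun u g) (sec_fun (g u) g^-1%g).
Proof.
by move=> w; rewrite {1}/sec_fun -sec_funE autK size_aut drop_size_cat.
Qed.

Lemma sec_tree_aut u g : tree_aut (sec_fun u g).
Proof.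
apply: (@tree_aut_can _ _ (sec_fun (g u) g^-1%g)); try exact: edge_sec.
  exact: sec_funK.
by have := sec_funK (g u) g^-1%g; rewrite autK invgK.
Qed.

Definition sec u g : aut p := Aut (sec_tree_aut u g).

Lemma secE u g w : g (u ++ w) = g u ++ sec u g w. Proof. exact: sec_funE. Qed.

Lemma secP u g s : (forall w, g (u ++ w) = g u ++ s w) -> sec u g = s.
Proof.
move=> gE; apply: aut_ext => w.
by have /eqP := gE w; rewrite secE eqseq_cat // eqxx => /eqP.
Qed.

Lemma secM u g h : sec u (g * h)%g = (sec u g * sec (g u) h)%g.
Proof. by apply: secP => w; rewrite !autM !secE. Qed.

Lemma sec1 u : sec u 1%g = 1%g. Proof. exact: secP. Qed.

Lemma sec_cat u v g : sec (u ++ v) g = sec v (sec u g).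
Proof. by apply: secP => w; rewrite -catA !secE catA. Qed.

Lemma sec_conj u g h : g u = u -> sec (h u) (g ^ h)%g = (sec u g ^ sec u h)%g.
Proof.
move=> gu; apply: secP => w.
have -> : h u ++ w = h (u ++ ((sec u h)^-1)%g w) by rewrite secE autVK.
by rewrite !autJ !autK secE gu secE.
Qed.

Lemma prefix_aut g u w : prefix (g u) (g w) = prefix u w.
Proof.
have pre (k : aut p) v v' : prefix v v' -> prefix (k v) (k v').
  by move=> /prefixP[t ->]; rewrite secE prefix_prefix.
by apply/idP/idP => [/(pre (g^-1)%g)|]; [rewrite !autK | exact: pre].
Qed.

Lemma prefix_cat_size u v w : size u = size v -> prefix u (v ++ w) = (u == v).
Proof.
by move=> suv; rewrite prefixE suv take_size_cat // eq_sym.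
Qed.

Definition graft_fun u s w := if prefix u w then u ++ s (drop (size u) w) else w.

Lemma graft_fun_cat u s w : graft_fun u s (u ++ w) = u ++ s w.
Proof. by rewrite /graft_fun prefix_prefix drop_size_cat. Qed.

Lemma edge_graft u s v w : edge v w -> edge (graft_fun u s v) (graft_fun u s w).
Proof.
move=> /edgeP[x ->]; apply/edgeP; case: (boolP (prefix u v)) => [/prefixP[t ->]|nuv].
  rewrite rcons_cat !graft_fun_cat; have [y ->] := aut_rcons s t x.
  by exists y; rewrite rcons_cat.
rewrite {2}/graft_fun (negPf nuv) /graft_fun.
case: ifP => [/prefixP[t]|_]; last by exists x.
case/lastP: t => [|t y]; last first.
  by rewrite -rcons_cat => /rcons_inj[E _]; rewrite E prefix_prefix in nuv.
by rewrite cats0 => E; rewrite E drop_size aut_nil cats0 -E; exists x.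
Qed.

Lemma graft_funK u s : cancel (graft_fun u s) (graft_fun u s^-1%g).
Proof.
move=> w; case: (boolP (prefix u w)) => [/prefixP[t ->]|nuw].
  by rewrite !graft_fun_cat autK.
by rewrite /graft_fun (negPf nuw) (negPf nuw).
Qed.

Lemma graft_tree_aut u s : tree_aut (graft_fun u s).
Proof.
apply: (@tree_aut_can _ _ (graft_fun u s^-1%g)); try exact: edge_graft.
  exact: graft_funK.
by have := graft_funK u s^-1%g; rewrite invgK.
Qed.

Definition graft u s : aut p := Aut (graft_tree_aut u s).

Lemma graft_cat u s w : graft u s (u ++ w) = u ++ s w.
Proof. exact: graft_fun_cat. Qed.

Lemma graft_out u s w : ~~ prefix u w -> graft u s w = w.
Proof. by move=> nuw; rewrite /= /graft_fun (negPf nuw). Qed.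

Lemma graft_level u v s : size v = size u -> graft u s v = v.
Proof.
move=> svu; have [->|nuv] := eqVneq v u.
  by have := graft_cat u s [::]; rewrite aut_nil !cats0.
by apply: graft_out; rewrite -[v]cats0 prefix_cat_size // eq_sym.
Qed.

Lemma sec_graft u s : sec u (graft u s) = s.
Proof. by apply: secP => w; rewrite graft_cat graft_level. Qed.

Lemma sec_graft_neq u v s : size v = size u -> v != u -> sec v (graft u s) = 1%g.
Proof.
move=> svu nvu; apply: secP => w; rewrite (graft_level _ svu) aut1 graft_out //.
by rewrite prefix_cat_size // eq_sym.
Qed.

Lemma graft_ext u s g : (forall w, g (u ++ w) = u ++ s w) ->
  (forall w, ~~ prefix u w -> g w = w) -> g = graft u s.
Proof.
move=> g_in g_out; apply: aut_ext => w.
case: (boolP (prefix u w)) => [/prefixP[t ->]|nuw].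
  by rewrite g_in graft_cat.
by rewrite g_out ?graft_out.
Qed.

Lemma graft1 u : graft u 1%g = 1%g. Proof. exact/esym/graft_ext. Qed.

Lemma graftM u s l : graft u (s * l)%g = (graft u s * graft u l)%g.
Proof.
apply/esym/graft_ext => w; first by rewrite autM !graft_cat.
by move=> nuw; rewrite autM !graft_out.
Qed.

Lemma graftV u s : graft u s^-1%g = (graft u s)^-1%g.
Proof.
by apply: (mulgI (graft u s)); rewrite -graftM !mulgV graft1.
Qed.

Lemma graft_conj u s h : (graft u s ^ h)%g = graft (h u) (s ^ sec u h)%g.
Proof.
apply: graft_ext => w.
  have -> : h u ++ w = h (u ++ ((sec u h)^-1)%g w) by rewrite secE autVK.
  by rewrite !autJ autK graft_cat secE.
rewrite -{1 2}[w](autVK h) prefix_aut => nuw.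
by rewrite autJ autVK graft_out ?autVK.
Qed.

Lemma graft_comm u v s l : size v = size u -> u != v ->
  (graft u s * graft v l = graft v l * graft u s)%g.
Proof.
move=> svu nuv; rewrite conjgC graft_conj graft_level // sec_graft_neq ?conjg1 //.
Qed.

(** An element of the rigid stabiliser fixes [u]: otherwise [g u], being of the same level, lies
    outside the subtree at [u] and is fixed by [g], against injectivity. *)
Lemma RstabE (G : set (aut p)) u g : Rstab G u g <-> G g /\ g = graft u (sec u g).
Proof.
split=> [[Gg g_out]|[Gg gE]]; last by split=> // w nuw; rewrite gE graft_out.
split=> //; apply: graft_ext => // w; rewrite secE; congr (_ ++ _).
apply/eqP; apply: contraT => ngu.
have ngp : ~~ prefix u (g u) by rewrite -[g u]cats0 prefix_cat_size ?size_aut // eq_sym.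
by have := congr1 (g^-1)%g (g_out _ ngp); rewrite !autK => E; rewrite E eqxx in ngu.
Qed.

(** The group [L_u]: the rigid stabiliser of [u], viewed as acting on the whole tree. *)
Definition rigid_part (G : set (aut p)) u : set (aut p) := [set s | G (graft u s)].

Lemma subgrp_rigid_part G u : subgrp G -> subgrp (rigid_part G u).
Proof.
move=> sG; split=> [|s l Gs Gl]; first by rewrite /rigid_part /= graft1; exact: subgrp1.
by rewrite /rigid_part /= graftM graftV; exact: sG.2.
Qed.

(** The other factors fix the subtree at [v] pointwise, and [h v] preserves it. *)
Lemma prod_Rstab (G : set (aut p)) n (h : n.-tuple 'I_p -> aut p) (v : n.-tuple 'I_p) w :
  (forall i : n.-tuple 'I_p, Rstab G i (h i)) ->
  (\prod_(i : n.-tuple 'I_p) h i)%g (v ++ w) = h v (v ++ w).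
Proof.
move=> Rh.
suff gen (r : seq (n.-tuple 'I_p)) x : uniq r ->
    (\prod_(i <- r) h i)%g (v ++ x) = if v \in r then h v (v ++ x) else v ++ x.
  by rewrite gen ?index_enum_uniq // mem_index_enum.
elim: r x => [|i r IH] x /=; first by rewrite big_nil.
case/andP=> ir ur; rewrite big_cons autM inE.
have [vi|nvi] := eqVneq v i.
  rewrite -vi in ir *; have [_ hvE] := (RstabE _ _ _).1 (Rh v).
  by rewrite hvE graft_cat IH // (negPf ir).
have [_ hi] := Rh i; rewrite hi ?IH //.
by rewrite prefix_cat_size ?size_tuple // eq_sym.
Qed.

End Sections.

(** * Spinal groups *)

Section SpinalGroup.
Variables (p : nat) (D : datum p).
Hypotheses (p_prime : prime p) (p_odd : odd p).
Local Notation S := (spinal_group D).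
Local Notation a := (rot_a p).
Implicit Types (g h s b z : aut p) (x y : 'I_p) (u v w : vertex p).

Let p_gt0 : (0 < p)%N. Proof. exact: prime_gt0. Qed.
Let sS : subgrp S. Proof. exact: subgrp_generated. Qed.

Lemma rot_in : S a. Proof. by apply: sub_generated; left. Qed.

Lemma gen_b_in (j : 'I_p) (i : 'I_(rk D j)) : S (gen_b i).
Proof. by apply: sub_generated; right; exists j, i. Qed.

Lemma rotX k x w : (a ^+ k)%g (x :: w) = iter k (@ordS p) x :: w.
Proof.
elim: k => [|k IH]; first by rewrite expg0.
by rewrite expgSr autM IH.
Qed.

Lemma val_iter_ordS k x : iter k (@ordS p) x = ((x + k) %% p)%N :> nat.
Proof.
elim: k => [|k IH] /=; first by rewrite addn0 modn_small.
by rewrite IH -addn1 modnDml addn1 addnS.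
Qed.

Lemma rotX_eq1 k : (p %| k)%N -> (a ^+ k = 1)%g.
Proof.
move=> pk; apply: aut_ext => -[|x w]; first by rewrite aut_nil.
rewrite rotX aut1; congr (_ :: _); apply: val_inj.
by rewrite /= val_iter_ordS -modnDmr (eqP pk) addn0 modn_small.
Qed.

Lemma rotp : (a ^+ p = 1)%g. Proof. exact: rotX_eq1. Qed.

Definition is_rot z := exists k, z = (a ^+ k)%g.

Lemma is_rot1 : is_rot 1%g. Proof. by exists 0%N; rewrite expg0. Qed.

Lemma is_rotM z z' : is_rot z -> is_rot z' -> is_rot (z * z')%g.
Proof. by move=> [k ->] [l ->]; exists (k + l)%N; rewrite expgnDr. Qed.

Lemma is_rotV z : is_rot z -> is_rot z^-1%g.
Proof.
move=> [k ->]; exists (p.-1 * k)%N; apply: (mulgI (a ^+ k)%g).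
rewrite mulgV -expgnDr -mulSn prednK //; apply/esym/rotX_eq1.
exact: dvdn_mulr.
Qed.

Lemma is_rotC z z' : is_rot z -> is_rot z' -> (z * z' = z' * z)%g.
Proof. by move=> [k ->] [l ->]; rewrite -!expgnDr addnC. Qed.

Lemma is_rot_order z : is_rot z -> (z ^+ p = 1)%g.
Proof. by move=> [k ->]; rewrite expgnAC rotp expg1n. Qed.

Lemma is_rot_in z : is_rot z -> S z.
Proof. by move=> [k ->]; exact: subgrpX k sS rot_in. Qed.

Lemma rot_conj_in z g : is_rot z -> S g -> S (g ^ z)%g.
Proof.
move=> /is_rot_in Sz Sg; exact: subgrpM sS (subgrpV sS Sz) (subgrpM sS Sg Sz).
Qed.

Lemma sec_rot x z : is_rot z -> sec [:: x] z = 1%g.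
Proof. by move=> [k ->]; apply: secP => w; rewrite !rotX. Qed.

Lemma rot_transitive x y : exists2 z, is_rot z & z [:: y] = [:: x].
Proof.
exists (a ^+ (x + (p - y)))%g; first by exists (x + (p - y))%N.
rewrite rotX; congr [:: _]; apply: val_inj.
by rewrite /= val_iter_ordS addnCA subnKC 1?ltnW // modnDr modn_small.
Qed.

Definition fixes_level1 g := forall x, g [:: x] = [:: x].
Definition stab1 : set (aut p) := [set g | S g /\ fixes_level1 g].

Lemma subgrp_stab1 : subgrp stab1.
Proof.
split; first by split; [exact: subgrp1 | ].
move=> g h [Sg g1] [Sh h1]; split=> [|x]; first exact: sS.2.
by rewrite autM g1 -{1}(h1 x) autK.
Qed.

Lemma level1_point g x : exists y, g [:: x] = [:: y].
Proof. by have := size_aut g [:: x]; case: (g _) => [|y []] //= _; exists y. Qed.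

Lemma fixes_level1J g h : fixes_level1 g -> fixes_level1 (g ^ h)%g.
Proof.
move=> g1 x; have [y E] := level1_point (h^-1)%g x.
by rewrite autJ E g1 -E autVK.
Qed.

Lemma sec_rot_conj z g x y : is_rot z -> fixes_level1 g -> z [:: y] = [:: x] ->
  sec [:: x] (g ^ z)%g = sec [:: y] g.
Proof. by move=> rz g1 <-; rewrite (sec_conj _ (g1 y)) (sec_rot _ rz) conjg1. Qed.

Lemma spinalX (k : 'I_p) (t : nat -> aut p) n x w :
  (spinal k t ^+ n)%g (x :: w) =
  x :: (if x == k then (spinal k t ^+ n)%g w else (t x ^+ n)%g w).
Proof.
elim: n x w => [|n IH] x w; first by rewrite !expg0 !aut1 if_same.
by rewrite !expgSr !autM IH /=; case: (x == k).
Qed.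

Lemma spinal_order (k : 'I_p) (t : nat -> aut p) n :
  (forall x, (t x ^+ n = 1)%g) -> (spinal k t ^+ n = 1)%g.
Proof.
move=> tn; apply: aut_ext; elim=> [|x w IH]; first by rewrite aut_nil.
by rewrite spinalX tn IH aut1; case: ifP.
Qed.

(* A class of elements that contains the [gen_b] and is stable under          *)
(* conjugation by the powers of [a].                                          *)
Definition spine_elt b := [/\ S b, fixes_level1 b, (b ^+ p = 1)%g &
  exists x0, forall x, x != x0 -> is_rot (sec [:: x] b)].

Lemma sec_spinal (k : 'I_p) (t : nat -> aut p) x :
  sec [:: x] (spinal k t) = if x == k then spinal k t else t x.
Proof.
by apply: secP => w; rewrite /= aut_nil; case: (x == k).
Qed.

Lemma is_rot_coord (j : 'I_p) (i : 'I_(rk D j)) n :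
  is_rot (nth 1%g (drop j (a_powers i) ++ 1%g :: take j (a_powers i)) n).
Proof.
set r := _ ++ _; have [lt_n|/(nth_default _)->] := ltnP n (size r); last first.
  exact: is_rot1.
have all_rot z : z \in a_powers i -> is_rot z.
  by case/mapP=> m _ ->; exists (vec D j i m).
have : nth 1%g r n \in r by exact: mem_nth.
rewrite {2}/r mem_cat inE => /or3P[/mem_drop|/eqP->|/mem_take]; try exact: all_rot.
exact: is_rot1.
Qed.

Lemma spine_gen_b (j : 'I_p) (i : 'I_(rk D j)) : spine_elt (gen_b i).
Proof.
have t_rot := is_rot_coord i.
split; first exact: gen_b_in.
- by move=> x; rewrite gen_b_psi1 aut_nil.
- by apply: spinal_order => x; apply: is_rot_order; exact: t_rot.
by exists (rev_ord j) => x nx; rewrite sec_spinal (negPf nx); exact: t_rot.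
Qed.

Lemma spine_conj b z : spine_elt b -> is_rot z -> spine_elt (b ^ z)%g.
Proof.
move=> [Sb b1 bp [x0 bx]] rz; split.
- exact: rot_conj_in.
- exact: fixes_level1J.
- by rewrite -conjXg bp conj1g.
have [x1 Ex1] := level1_point z x0; exists x1 => x nx.
have [y Ey] := level1_point (z^-1)%g x.
have zy : z [:: y] = [:: x] by rewrite -Ey autVK.
rewrite (sec_rot_conj rz b1 zy); apply: bx; apply: contraNneq nx => yx.
by move: zy; rewrite yx Ex1 => -[->].
Qed.

(* As p >= 3, some coordinate avoids both spines, and there both sections are *)
(* powers of [a].                                                             *)
Lemma spine_commutator b c : spine_elt b -> spine_elt c ->
  stab1 (b * c * (c * b)^-1)%g /\ exists x, sec [:: x] (b * c * (c * b)^-1)%g = 1%g.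
Proof.
move=> [Sb b1 _ [x0 bx]] [Sc c1 _ [x1 cx]].
have Hb : stab1 b by []. have Hc : stab1 c by [].
have sH := subgrp_stab1.
split; first by apply: sH.2; exact: subgrpM.
have [x] : exists x, x \notin [set x0; x1]%SET.
  apply/existsP; rewrite -negb_forall; apply: contraL (prime_gt1 p_prime).
  move/forallP=> allx; have : (#|{: 'I_p}| <= #|[set x0; x1]%SET|)%N.
    by apply/subset_leq_card/fintype.subsetP=> x _; exact: allx.
  rewrite card_ord cards2 => p2.
  have : (p <= 2)%N by apply: leq_trans p2 _; case: (_ == _).
  by move: p_prime p_odd; case: (p) => [|[|[|]]].
rewrite !inE negb_or => /andP[/bx bx' /cx cx']; exists x.
have secbc d e : stab1 d -> stab1 e ->
    sec [:: x] (d * e)%g = (sec [:: x] d * sec [:: x] e)%g.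
  by move=> [_ d1] _; rewrite secM d1.
have E : sec [:: x] (b * c)%g = sec [:: x] (c * b)%g.
  by rewrite !secbc // is_rotC.
apply: (mulIg (sec [:: x] (c * b)%g)); rewrite mul1g -secbc ?mulgVK //.
  by apply: sH.2; exact: subgrpM.
exact: subgrpM.
Qed.

(** The group [N] generated by the spine elements is normalised by the rotations, so [N] times the
    rotations is a group and contains [S]. A rotation fixing the first level is trivial, hence
    [stab1] lies in [N]. *)
Lemma stab1_generated (X : set (aut p)) : subgrp X -> spine_elt `<=` X -> stab1 `<=` X.
Proof.
move=> sX BX h [Sh h1].
pose N : set (aut p) := generated spine_elt.
have sN : subgrp N by exact: subgrp_generated.
have N1 g : N g -> fixes_level1 g.
  have := generated_min (A := spine_elt) subgrp_stab1.
  by move=> sub Ng; have [] : stab1 g by apply: sub Ng => b [].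
have NJ z g : is_rot z -> N g -> N (g ^ z)%g.
  move=> rz; apply: (generated_min (subgrp_conj z sN)) => b bb.
  by apply: sub_generated; exact: spine_conj.
pose Y := [set g | exists2 z, is_rot z & N (g * z)%g].
have sY : subgrp Y.
  split; first by exists 1%g; [exact: is_rot1 | rewrite mulg1; exact: subgrp1].
  move=> g g' [z rz Ng] [z' rz' Ng']; exists (z'^-1 * z)%g.
    by apply: is_rotM => //; exact: is_rotV.
  suff -> : (g * g'^-1 * (z'^-1 * z) =
     (g * z) * ((g' * z') ^ (z'^-1 * z))^-1 )%g.
    by apply: sN.2 => //; apply: NJ => //; apply: is_rotM => //; exact: is_rotV.
  by rewrite -conjVg conjgE !invgM invgK !mulgA !mulgK.
have [z rz Nhz] : Y h.
  apply: (generated_min sY _ Sh) => g [->|[j [i ->]]].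
    by exists a^-1%g; [apply: is_rotV; exists 1%N; rewrite expg1 | rewrite mulgV; exact: subgrp1].
  exists 1%g; first exact: is_rot1.
  by rewrite mulg1; apply: sub_generated; exact: spine_gen_b.
have z1 : z = 1%g.
  case: rz Nhz => k ->{z} /N1 hk1; apply: rotX_eq1.
  have := hk1 (Ordinal p_gt0); rewrite autM h1 rotX => -[/(congr1 val)].
  by rewrite /= val_iter_ordS add0n => /eqP.
by move: Nhz; rewrite z1 mulg1 => Nh; exact: generated_min sX BX _ Nh.
Qed.

Lemma sec_in1 x g : S g -> S (sec [:: x] g).
Proof.
move=> Sg; move: x.
suff : (S `&` [set g | forall x, S (sec [:: x] g)]) g by case.
apply: (generated_min _ _ Sg); last first.
  move=> _ [->|[j [i ->]]]; split; [exact: rot_in| |exact: gen_b_in|] => x.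
    by rewrite -[a]expg1 sec_rot; [exact: subgrp1 | exists 1%N].
  rewrite sec_spinal; case: ifP => _; first exact: gen_b_in.
  exact/is_rot_in/is_rot_coord.
split; first by split=> [|x]; rewrite ?sec1; exact: subgrp1.
move=> h k [Sh hS] [Sk kS]; split=> [|x]; first exact: sS.2.
rewrite secM; apply: (subgrpM sS) => //.
have [y ->] := level1_point h x.
have -> : sec [:: y] k^-1%g = (sec ((k^-1)%g [:: y]) k)^-1%g.
  by apply: (mulIg (sec ((k^-1)%g [:: y]) k)); rewrite -secM !mulVg sec1.
by apply: (subgrpV sS); have [z ->] := level1_point (k^-1)%g y.
Qed.

Lemma sec_in u g : S g -> S (sec u g).
Proof.
elim: u g => [|x u IH] g Sg; last by rewrite -cat1s sec_cat; apply/IH/sec_in1.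
by rewrite (_ : sec [::] g = g) //; apply: secP => w; rewrite aut_nil.
Qed.

(** With indices from 0, entry [m] sits at coordinate [m - j] if [j <= m], and otherwise at
    [p - j + m], past the spine at [p - 1 - j]. *)
Lemma coord_onto (j : 'I_p) (i : 'I_(rk D j)) (m : 'I_p.-1) :
  exists x, sec [:: x] (gen_b i) = (a ^+ vec D j i m)%g.
Proof.
have sz : size (a_powers i) = p.-1 by rewrite size_map size_enum_ord.
have ap : nth 1%g (a_powers i) m = (a ^+ vec D j i m)%g.
  by rewrite (nth_map m) ?size_enum_ord // nth_ord_enum.
have jp := ltn_ord j; have mp := ltn_ord m.
have szd : size (drop j (a_powers i)) = (p.-1 - j)%N by rewrite size_drop sz.
have [le_jm|lt_mj] := leqP j m.
  have xp : (m - j < p)%N by lia.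
  exists (Ordinal xp); rewrite sec_spinal -val_eqE /= ifF; last by apply/eqP; lia.
  by rewrite nth_cat szd ifT ?nth_drop ?subnKC //; lia.
have xp : (p - j + m < p)%N by lia.
exists (Ordinal xp); rewrite sec_spinal -val_eqE /= ifF; last by apply/eqP; lia.
rewrite nth_cat szd ifF; last by apply/negP; lia.
have -> : (p - j + m - (p.-1 - j) = m.+1)%N by lia.
by rewrite /= nth_take.
Qed.

(** Linear independence gives a vector with an entry [e] non-zero modulo [p]. Raising [gen_b i] to
    an inverse [km] of [e] modulo [p] turns the section [a ^+ e] into [a]. *)
Lemma exists_rot_section : exists b x, stab1 b /\ sec [:: x] b = a.
Proof.
have [j rk_j] := rk_neq0 D; rewrite -lt0n in rk_j; pose i := Ordinal rk_j.
have [m m0] : exists m, vec D j i m != 0.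
  apply/existsP; rewrite -negb_forall; apply/negP => /forallP vec0.
  have : delta_mx 0 i = 0 :> 'rV['F_p]_(rk D j).
    apply: (row_free_inj (vec_free D j)); rewrite /= mul0mx -rowE.
    by apply/rowP => m; rewrite !mxE; apply/eqP.
  by move/rowP/(_ i)/eqP; rewrite !mxE !eqxx oner_eq0.
have [x bx] := coord_onto i m; set e : nat := vec D j i m in bx *.
have e_gt0 : (0 < e)%N by rewrite lt0n.
have e_ltp : (e < p)%N by rewrite -[X in (_ < X)%N](Fp_cast p_prime) ltn_ord.
have [km kn E _] := egcdnP p e_gt0.
have [Sb b1 _ _] := spine_gen_b i; have Hb : stab1 (gen_b i) by [].
have sH := subgrp_stab1.
exists (gen_b i ^+ km)%g, x; split; first exact: subgrpX.
have -> n : sec [:: x] (gen_b i ^+ n)%g = (sec [:: x] (gen_b i) ^+ n)%g.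
  elim: n => [|n IH]; first by rewrite !expg0 sec1.
  by rewrite !expgS secM b1 IH.
rewrite bx -expgnA mulnC E expgnDr rotX_eq1 ?dvdn_mull // mul1g.
suff /eqP-> : gcdn e p == 1%N by rewrite expg1.
by rewrite -/(coprime e p) coprime_sym prime_coprime // gtnNdvd.
Qed.

(** Each [gen_b i] is its own section at the spine, and [a] is a section by [exists_rot_section].
    Conjugation by a rotation moves either to the coordinate [x]. *)
Lemma sec_onto1 x s : S s -> exists2 h, stab1 h & sec [:: x] h = s.
Proof.
move=> Ss; pose Y := [set s | exists2 h, stab1 h & sec [:: x] h = s].
have sH := subgrp_stab1.
have secHM g h : stab1 g -> stab1 h -> sec [:: x] (g * h^-1)%g = (sec [:: x] g * (sec [:: x] h)^-1)%g.
  move=> Hg Hh; apply: (mulIg (sec [:: x] h)).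
  have [_ /(_ x) E] : stab1 (g * h^-1)%g by exact: sH.2.
  by rewrite mulgVK -[in RHS](mulgVK h g) [RHS]secM E.
have sY : subgrp Y.
  split; first by exists 1%g; [exact: subgrp1 | exact: sec1].
  move=> _ _ [g Hg <-] [h Hh <-]; exists (g * h^-1)%g; last exact: secHM.
  exact: sH.2.
have shift b y : stab1 b -> Y (sec [:: y] b).
  move=> [Sb b1]; have [z rz zy] := rot_transitive x y.
  exists (b ^ z)%g; last exact: sec_rot_conj.
  split; last exact: fixes_level1J.
  exact: rot_conj_in.
apply: (generated_min sY _ Ss) => _ [->|[j [i ->]]].
  by have [b [y [Hb <-]]] := exists_rot_section; exact: shift.
have [Sb b1 _ _] := spine_gen_b i.
rewrite -{1}(_ : sec [:: rev_ord j] (gen_b i) = gen_b i); first exact: shift.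
by rewrite sec_spinal eqxx.
Qed.

Lemma sec_onto u s : S s -> exists h, [/\ S h, h u = u & sec u h = s].
Proof.
elim: u s => [|x u IH] s Ss.
  exists s; split=> //; first by rewrite aut_nil.
  by apply: secP => w; rewrite aut_nil.
have [h [Sh hu <-]] := IH s Ss; have [k [Sk k1] kh] := sec_onto1 x Sh.
exists k; split=> //; last by rewrite -cat1s sec_cat kh.
by rewrite -cat1s secE k1 kh hu.
Qed.

End SpinalGroup.

(** * Rigid stabilisers in a branch conjugate of a spinal group *)

Section ConjugateSpinal.
Variables (p : nat) (D : datum p) (E : nzRingType) (G : set (aut p)) (f : aut p).
Hypotheses (p_prime : prime p) (p_odd : odd p).
Local Notation S := (spinal_group D).
Hypothesis GE : G = [set (h ^ f)%g | h in S].
Hypothesis G_branch : branch G.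

Let sS : subgrp S. Proof. exact: subgrp_generated. Qed.

Let GJ h : G (h ^ f)%g <-> S h.
Proof.
rewrite GE; split=> [[h' Sh' /conjg_inj <-] //|Sh]; by exists h.
Qed.

Let G_rigid u s : rigid_part G (f u) (s ^ sec u f)%g <-> rigid_part S u s.
Proof. by rewrite /rigid_part /= -graft_conj GJ. Qed.

Let sG : subgrp G.
Proof.
split; first by rewrite -(conj1g f) GJ; exact: subgrp1.
move=> x y; rewrite -[x](conjgKV f) -[y](conjgKV f) -conjVg -conjMg !GJ; exact: sS.2.
Qed.

(** Every element of [S] is the section at [u] of some [h] in [S] fixing [u]. Finitely many cosets
    of [RstabL G n] contain all these [h ^ f], and elements of [RstabL G n] have their section at
    [f u] in the rigid part there; conjugate back by [f]. *)
Lemma rigid_cover u : exists t, covers (rigid_part S u) S t.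
Proof.
have [_ /(_ (size u))] := G_branch; set n := size u; set X := RstabL G n.
move=> /finite_seqP[c cE].
have X1 : X 1%g.
  by exists (fun _ => 1%g); [move=> w; split=> //; exact: subgrp1 | rewrite big1].
pose coset (g : aut p) := [set (h * g)%g | h in X].
have [t [tG tc]] : exists t : seq (aut p), (forall y, y \in t -> G y) /\
    forall g, G g -> exists2 y, y \in t & coset g = coset y.
  pose pick q := if pselect (exists2 g, G g & coset g = q) is left e
                 then s2val (cid2 e) else 1%g.
  have pickP g : G g -> G (pick (coset g)) /\ coset (pick (coset g)) = coset g.
    move=> Gg; rewrite /pick; case: pselect => [e|[]]; last by exists g.
    by case: cid2.
  have pick_in q : G (pick q).
    by rewrite /pick; case: pselect => [e|_]; [case: cid2 | exact: subgrp1].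
  exists [seq pick q | q <- c]; split=> [_ /mapP[q _ ->] //|g Gg].
  have [_ cg] := pickP g Gg; exists (pick (coset g)) => //.
  apply: map_f; have : [set` c] (coset g) by rewrite -cE; exists g.
  by [].
exists [seq sec u (y ^ f^-1)%g | y <- t]; split.
  move=> _ /mapP[y /tG Gy ->]; apply: sec_in => //.
  by rewrite -GJ conjgKV.
move=> s Ss; have [h [Sh hu <-{s Ss}]] := sec_onto p_prime p_odd u Ss.
have [y ty cy] := tc _ ((GJ h).2 Sh).
exists (sec u (y ^ f^-1)%g); first exact: map_f.
have [r Xr hE] : coset y (h ^ f)%g.
  by rewrite -cy; exists 1%g; rewrite ?mul1g.
have {}hE : h = ((r ^ f^-1) * (y ^ f^-1))%g by rewrite -conjMg hE conjgK.
pose v : n.-tuple 'I_p := Tuple (introT eqP (size_aut f u)).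
have [k Rk rE] := Xr.
have [Gk kE] := (RstabE _ _ _).1 (Rk v).
have r_v w : r (f u ++ w) = k v (f u ++ w) by rewrite -rE (prod_Rstab v w Rk).
have kv : k v (f u) = f u by have [_ ->] := (RstabE _ _ _).1 (Rk v); rewrite graft_level.
have r_u : r (f u) = f u by have := r_v [::]; rewrite cats0 kv.
have ru : (r ^ f^-1)%g u = u by rewrite autJ invgK r_u autK.
have secr : sec (f u) r = sec (f u) (k v).
  by apply: secP => w; rewrite r_u r_v secE kv.
have -> : (sec u h * (sec u (y ^ f^-1))^-1 = sec u (r ^ f^-1))%g.
  by rewrite hE secM ru mulgK.
rewrite -G_rigid -sec_conj // conjgKV secr /rigid_part /=.
by move: Gk; rewrite {1}kE.
Qed.

(** [L] is normal because each element of [S] is a section at [u] of an element fixing [u], and has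
    finite index by [rigid_cover]. So [minimal_radical] applies to first-level sections; spine
    commutators have a trivial one and lie in [J]. *)
Lemma radical_core u : aug_radical E (rigid_part S u) ->
  exists J t, [/\ radical_cover E S J t,
    forall b c, spine_elt D b -> spine_elt D c -> J (b * c * (c * b)^-1)%g &
    forall X, subgrp X -> J `<=` X -> spine_elt D `<=` X -> S `<=` X].
Proof.
move=> TL; have sH := subgrp_stab1 D.
pose L := rigid_part S u.
have cover_L : exists J t, radical_cover E S J t.
  have [t tL] := rigid_cover u; exists L, t; split=> //.
  - exact: subgrp_rigid_part.
  - by move=> s Ls; rewrite -(sec_graft u s); exact: sec_in.
  move=> s l Ss Ll; have [h [Sh hu <-]] := sec_onto p_prime p_odd u Ss.
  rewrite /L /rigid_part /= -{1}hu -graft_conj conjgE.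
  exact: subgrpM sS (subgrpV sS Sh) (subgrpM sS Ll Sh).
have [||||J [t [JT SHJ secJ]]] := minimal_radical
  (psi := fun x => sec [:: x]) (H := stab1 D) (Ordinal (prime_gt0 p_prime)) sS sH _ _ _ _ cover_L.
- by move=> g [].
- by move=> x g h [_ g1] _; rewrite secM g1.
- by move=> x g [Sg _]; exact: sec_in.
- by move=> x g; exact: sec_onto1.
exists J, t; split=> // [b c bb cc|X sX JX BX s Ss].
  have [Hbc [x bc1]] := spine_commutator p_prime p_odd bb cc; exact: secJ bc1.
have [h Hh Jh] := SHJ s Ss.
rewrite -[s](mulgVK h); apply: subgrpM => //; first exact: JX.
exact: (stab1_generated p_prime sX BX).
Qed.

(** Conjugation by the section of [f] at [u] identifies the rigid part of [S] at [u] with that of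
    [G] at [f u]. *)
Lemma rigid_part_conj v : aug_radical E (rigid_part G v) ->
  exists u, aug_radical E (rigid_part S u).
Proof.
move=> TG; exists ((f^-1)%g v); set u := (f^-1)%g v; set c := sec u f.
have fu : f u = v by rewrite autVK.
have sGv : subgrp (rigid_part G v) by exact: subgrp_rigid_part.
apply: (aug_radical_image (phi := fun s => (s ^ c^-1)%g) sGv _ _ _ TG).
- by move=> x y _ _; rewrite conjMg.
- by move=> x Gx; rewrite -G_rigid -/c conjgKV fu.
- by move=> y; rewrite -G_rigid -/c fu => Gy; exists (y ^ c)%g => //; rewrite conjgK.
Qed.

End ConjugateSpinal.

(** A left translation brings a non-zero value of [f] to the identity and commutes with the right
    translations in the relation. *)
Lemma not_aug_radical (E : nzRingType) (gT : groupType) (X : set gT) :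
  subgrp X -> ~ aug_radical E X ->
  exists (r : gT) (b : seq (E * gT)) (f : gT -> E),
    [/\ X r, forall ch, ch \in b -> X ch.2, f 1%g != 0 &
     forall x, X x ->
       f x = \sum_(ch <- b) ch.1 * (f (x * ch.2 * r)%g - f (x * ch.2)%g)].
Proof.
move=> sX nTX; apply: contrapT => nex; apply: nTX => r b f Xr Xb fE x Xx.
apply: contrapT => fx; apply: nex; exists r, b, (fun y => f (x * y)%g).
split=> // [|y Xy]; first by rewrite mulg1; apply/eqP.
by rewrite fE; [apply: eq_bigr => ch _; rewrite !mulgA | exact: subgrpM].
Qed.

(** * Functions supported on the product of the rigid parts of a level *)

Section Support.
Variables (p : nat) (E : fieldType) (G : groupClosed (aut p)) (n : nat).
Local Notation gT := (sgroup G).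
Local Notation I := (n.-tuple 'I_p).

Definition level_rigid (v : I) : set gT := [set x | exists s, val x = graft v s].
Definition level_act (x : gT) (v : I) : I := Tuple (introT eqP (etrans (size_aut (val x) v) (size_tuple v))).

Hypothesis rigid_n : forall v : vertex p, ~ aug_radical E (rigid_part [set` G] v).

(** [f] multiplies, over [v] in [K], the functions given by [not_aug_radical] at the sections, and
    is zero off [N]. Right multiplication by an element rigid at [i] preserves [N] and, on [N],
    changes only the section at [i]. *)
Lemma level_support (K : {set I}) : exists f : gT -> E, [/\ f 1%g != 0,
    forall i r x, i \notin K -> level_rigid i r -> f (x * r)%g = f x &
    forall i, i \in K -> exists r b,
     [/\ level_rigid i r, forall ch, ch \in b -> level_rigid i ch.2 &
     forall x, f x = \sum_(ch <- b) ch.1 * (f (x * ch.2 * r)%g - f (x * ch.2)%g)]].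
Proof.
have sG := subgrp_closed G.
have sL v := subgrp_rigid_part v sG.
pose good (v : I) (q : aut p * seq (E * aut p) * (aut p -> E)) :=
  [/\ rigid_part [set` G] v q.1.1,
    forall ch, ch \in q.1.2 -> rigid_part [set` G] v ch.2, q.2 1%g != 0 &
    forall x, rigid_part [set` G] v x -> q.2 x =
      \sum_(ch <- q.1.2) ch.1 * (q.2 (x * ch.2 * q.1.1)%g - q.2 (x * ch.2)%g)].
have exq v : exists q, good v q.
  have [r [b [F [Lr Lb F1 FE]]]] := not_aug_radical (sL v) (@rigid_n v).
  by exists (r, b, F).
pose q v := projT1 (cid (exq v)).
have qP v : good v (q v) by rewrite /q; case: cid.
pose F v := (q v).2.
pose N := [set x : gT | forall v : I, val x v = v :> vertex p /\
                          rigid_part [set` G] v (sec v (val x))].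
have sN : subgrp N.
  split=> [v|x y Nx Ny v].
    by rewrite [val _]val1 aut1 sec1; split=> //; exact: subgrp1.
  have [xv Lx] := Nx v; have [yv Ly] := Ny v.
  have yVv : ((val y)^-1)%g v = v :> vertex p by rewrite -{1}yv autK.
  have -> : val (x * y^-1)%g = (val x * (val y)^-1)%g by [].
  rewrite autM xv yVv secM xv; split=> //.
  suff -> : sec v (val y)^-1%g = (sec v (val y))^-1%g by exact: (sL v).2.
  by apply: (mulIg (sec v (val y))); have := secM v (val y)^-1%g (val y);
    rewrite !mulVg sec1 yVv => <-.
pose f x : E := if `[< N x >] then \prod_(v in K) F v (sec v (val x)) else 0.
have fN x : N x -> f x = \prod_(v in K) F v (sec v (val x)).
  by move=> Nx; rewrite /f asboolT.
have fnN x : ~ N x -> f x = 0 by move=> Nx; rewrite /f asboolF.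
have sz (v i : I) : size v = size i by rewrite !size_tuple.
have N_level i r : level_rigid i r -> N r.
  move=> [s rE] v; rewrite rE; split; first exact: graft_level.
  have [->|nvi] := eqVneq v i; last first.
    by rewrite sec_graft_neq //; exact: subgrp1.
  by rewrite sec_graft; have := valP r; rewrite rE.
have nN x r i : level_rigid i r -> ~ N x -> ~ N (x * r)%g.
  move=> /N_level Nr nNx Nxr; apply: nNx; rewrite -[x](mulgK r); exact: sN.2.
have sec_mul x r (v : I) : N x -> sec v (val (x * r)%g) = (sec v (val x) * sec v (val r))%g.
  by move=> /(_ v)[xv _]; have := secM v (val x) (val r); rewrite xv.
exists f; split.
- rewrite fN; last exact: subgrp1.
  apply/prodf_neq0 => v _; rewrite [val _]val1 sec1.
  by have [_ _] := qP v.
- move=> i r x iK Lr; have [Nx|nNx] := pselect (N x); last first.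
    by rewrite !fnN //; exact: nN Lr nNx.
  rewrite !fN //; last by apply: (subgrpM sN) => //; exact: N_level Lr.
  apply: eq_bigr => v vK; rewrite sec_mul //; have [s ->] := Lr.
  rewrite sec_graft_neq ?mulg1 //; apply: contraNneq iK => vi.
  by rewrite -(val_inj vi).
move=> i iK; have [Lr Lb _ FE] := qP i.
pose up s : gT := insubd 1%g (graft i s).
have upE s : rigid_part [set` G] i s -> val (up s) = graft i s.
  by move=> Ls; rewrite /up insubdK.
have up_level s : rigid_part [set` G] i s -> level_rigid i (up s).
  by move=> Ls; exists s; exact: upE.
exists (up (q i).1.1), [seq (ch.1, up ch.2) | ch <- (q i).1.2]; split.
- exact: up_level.
- by move=> _ /mapP[ch /Lb Lh ->]; exact: up_level.
move=> x; rewrite big_map.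
have [Nx|nNx] := pselect (N x); last first.
  (* Right translates of [x] by elements rigid at [i] stay outside [N], so both sides vanish. *)
  rewrite fnN // big_seq big1 // => ch /Lb/up_level Lh.
  have nNxh := nN _ _ _ Lh nNx.
  by rewrite !fnN ?subr0 ?mulr0 //; exact: nN (up_level _ Lr) nNxh.
have fup y s : N y -> rigid_part [set` G] i s -> f (y * up s)%g =
    F i (sec i (val y) * s)%g * \prod_(v in K | v != i) F v (sec v (val y)).
  move=> Ny Ls; rewrite fN; last by apply: (subgrpM sN) => //; exact: N_level (up_level _ Ls).
  rewrite (bigD1 i) //= sec_mul // upE // sec_graft; congr (_ * _).
  by apply: eq_bigr => v /andP[_ vi]; rewrite sec_mul // upE // sec_graft_neq ?mulg1.
have Lx : rigid_part [set` G] i (sec i (val x)) by have [] := Nx i.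
rewrite fN // (bigD1 i) //= {1}/F FE // mulr_suml big_seq [RHS]big_seq.
apply: eq_bigr => ch chb; have Lh := Lb _ chb.
have Nxh : N (x * up ch.2)%g by apply: (subgrpM sN) => //; exact: N_level (up_level _ Lh).
rewrite !fup // sec_mul // upE // sec_graft -mulrA mulrBl; congr (_ * (_ * _ - _)).
apply: eq_bigr => v /andP[_ vi].
by rewrite sec_mul // upE // sec_graft_neq ?mulg1.
Qed.

End Support.

(** * Irreducible modules of a branch group in the class *)

Theorem theorem1p7 (p : nat) (p_prime : prime p) (p_odd : odd p)
    (G : groupClosed (aut p))
    (G_class : class_C [set` G]) (G_branch : branch [set` G])
    (E : closedFieldType) (E_char : p \in [pchar E]) :
  (exists M : lmodType (grpalg E (sgroup G)),
     irreducible_module M /\ ~ trivial_module M) ->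
  exists M : nat -> lmodType (grpalg E (sgroup G)),
    (forall i, irreducible_module (M i)) /\
    (forall i j, i <> j -> ~ module_iso (M i) (M j)).
Proof.
move=> [M [irrM ntM]]; have [D [f GE]] := G_class.
(* If some rigid part satisfied the radical condition, [M] would be trivial by
   [only_trivial_module]. *)
have rigid_n v : ~ aug_radical E (rigid_part [set` G] v).
  move=> /(rigid_part_conj GE)[u Tu]; apply: ntM.
  have [J [t [[sJ JS nJ TJ [tS tJ]] BJ genJB]]] :=
    radical_core p_prime p_odd GE G_branch Tu.
  have sS : subgrp (spinal_group D) := subgrp_generated _.
  (* [c] identifies [sgroup G] with the spinal group, with inverse [up]; [J] and the spine elements
     are transported along it. *)
  pose c (x : sgroup G) := (val x ^ f^-1)%g.
  have cS x : spinal_group D (c x).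
    have : [set` G] (val x) by exact: valP.
    by rewrite GE /c => -[h Sh <-]; rewrite conjgK.
  pose up s : sgroup G := insubd 1%g (s ^ f)%g.
  have cK s : spinal_group D s -> c (up s) = s.
    move=> Ss; have Gs : [set` G] (s ^ f)%g by rewrite GE; exists s.
    by rewrite /c /up insubdK ?conjgK.
  have cM x y : c (x * y)%g = (c x * c y)%g by rewrite /c valM conjMg.
  have cV x : c x^-1%g = (c x)^-1%g.
    by apply: (mulIg (c x)); rewrite -cM !mulVg /c val1 conj1g.
  have c_inj : injective c by move=> x y /conjg_inj/val_inj.
  have upK x : up (c x) = x by apply: c_inj; exact: cK.
  have sJ' : subgrp [set x | J (c x)].
    split=> [|x y Jx Jy]; first by rewrite /= /c val1 conj1g; exact: subgrp1.
    by rewrite /= cM cV; exact: sJ.2.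
  apply: (only_trivial_module (J := [set x | J (c x)]) (t := map up t)
    (B := [set x | spine_elt D (c x)]) E_char irrM) => //.
  - by move=> x y _ Jy; rewrite /= conjgE !cM cV -conjgE; exact: nJ.
  - apply: (aug_radical_image (phi := up) sJ _ _ _ TJ).
    + by move=> x y /JS Sx /JS Sy; apply: c_inj; rewrite cM !cK //; exact: subgrpM sS Sx Sy.
    + by move=> x Jx; rewrite /= cK //; exact: JS.
    + by move=> y Jy; exists (c y).
  - split=> // x _; have [y ty Jy] := tJ _ (cS x).
    by exists (up y); [exact: map_f | rewrite /= cM cV cK //; exact: tS].
  - have cX b k : c (b ^+ k)%g = (c b ^+ k)%g.
      elim: k => [|k IH]; first by rewrite !expg0 /c val1 conj1g.
      by rewrite !expgS cM IH.
    by move=> b [_ _ bp _]; apply: c_inj; rewrite cX bp /c val1 conj1g.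
  - by move=> b d Bb Bd; rewrite /= cM cV !cM; exact: BJ.
  - move=> X sX JX BX x; rewrite -[x]upK.
    suff : [set s | spinal_group D s /\ X (up s)] (c x) by case.
    apply: genJB; [| | | exact: cS].
    + split=> [|s s' [Ss Xs] [Ss' Xs']].
        split; first exact: subgrp1.
        rewrite (_ : up 1%g = 1%g); first exact: subgrp1.
        by apply: c_inj; rewrite (cK _ (subgrp1 sS)) /c val1 conj1g.
      have Sss' : spinal_group D (s * s'^-1)%g by exact: sS.2.
      split=> //; rewrite (_ : up (s * s'^-1)%g = (up s * (up s')^-1)%g); first exact: sX.2.
      by apply: c_inj; rewrite cM cV !cK.
    + by move=> s Js; split; [exact: JS | apply: JX; rewrite /= cK //; exact: JS].
    + move=> s Bs; have [Ss _ _ _] := Bs; split=> //; apply: BX.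
      by rewrite /= cK.
apply: infinitely_many_irreducibles => n.
(* Level [n] has [p ^ n] vertices, and [n < p ^ n], so it supplies at least [n] modules. *)
have le_n : (n <= #|{: n.-tuple 'I_p}|)%N.
  by rewrite card_tuple card_ord ltnW // ltn_expl // prime_gt1.
have [||||W [irrW nisoW]] := @many_irreducibles E (sgroup G) (n.-tuple 'I_p)
   (@level_rigid p G n) (@level_act p G n).
- move=> i j r s ij [k rE] [l sE]; apply: val_inj; rewrite !valM rE sE.
  by rewrite graft_comm ?size_tuple.
- move=> g i j /(congr1 val)/= gij; apply: val_inj.
  exact: (can_inj (autK (val g)) gij).
- move=> g i r [s rE]; exists (s ^ sec i (val g))%g.
  by rewrite -graft_conj -rE gmulfJ.
- exact: level_support.
by exists (fun i => W (widen_ord le_n i)); split=> // i j ij; exact: nisoW.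
Qed.
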